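(* Let $\alpha>1$. There is a $\mathcal C^\alpha$-complex Frobenius structure $\mathcal S$ on $\mathbb R^3$ such that $\operatorname{rank}\mathcal S=1$, $\operatorname{rank}(\mathcal S+\bar{\mathcal S})=2$, and there does not exist a $C^1$-coordinate chart $F:U\subseteq\mathbb R^3\to\mathbb C^1_z\times\mathbb R^1_s$ on a neighborhood $U$ of $0\in\mathbb R^3$ such that $F^*\frac{\partial}{\partial z}$ spans $\mathcal S|_U$ and $F^*\frac{\partial}{\partial z}\in\mathcal C^\alpha(U;\mathbb C^3)$.
   Context: Hölder-Zygmund classes: for a convex open $\Omega\subseteq\mathbb R^n$ and $0<\alpha<1$, $\mathcal C^\alpha(\Omega)$ is the space of bounded continuous $f$ with $\sup_{x\ne y}|x-y|^{-\alpha}|f(x)-f(y)|<\infty$; $\mathcal C^1(\Omega)$ is the space of bounded continuous $f$ with $\sup_{x\neq y}|x-y|^{-1}\left|\frac{f(x)+f(y)}2-f(\frac{x+y}2)\right|<\infty$; for $\alpha>1$, $f\in\mathcal C^\alpha$ iff $f,\partial_1f,\dots,\partial_nf\in\mathcal C^{\alpha-1}$. A $\mathcal C^\alpha$-complex tangent subbundle $\mathcal S\le\mathbb CT\mathbb R^3$ of rank $k$ is a subset such that each fibre is a $k$-dimensional complex subspace of $\mathbb CT_p\mathbb R^3$ and near every point it is spanned, at every nearby point, by $k$ pointwise linearly independent (locally) $\mathcal C^\alpha$ complex vector fields. $\bar{\mathcal S}$ is the complex conjugate subbundle. For $\alpha>1$, $\mathcal S$ is a $\mathcal C^\alpha$-complex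 Frobenius structure if it is a $\mathcal C^\alpha$-complex tangent subbundle, $\mathcal S+\bar{\mathcal S}$ is also a complex tangent subbundle, and both $\mathcal S$ and $\mathcal S+\bar{\mathcal S}$ are involutive, i.e. for $C^1$ sections $X,Y$ of the bundle, $[X,Y]$ is a $C^0$ section of the same bundle. For a $C^1$-chart $F$ with inverse $\Phi$, $F^*\frac{\partial}{\partial z}=\frac{\partial\Phi}{\partial z}\circ F$ is a continuous complex vector field, where $\frac{\partial}{\partial z}=\frac12(\frac{\partial}{\partial x}-i\frac{\partial}{\partial y})$, $z=x+iy$. *)

(* Defs.v *)
From HB Require Import structures.
From mathcomp Require Import all_boot all_order all_algebra.
From mathcomp Require Import complex.
From mathcomp Require Import all_classical all_reals all_analysis.

Set Implicit Arguments.
Unset Strict Implicit.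
Unset Printing Implicit Defensive.

Import Order.TTheory GRing.Theory Num.Theory.
Import numFieldNormedType.Exports.

Local Open Scope classical_set_scope.
Local Open Scope ring_scope.
Local Open Scope complex_scope.

Definition std_basis {R : realType} {n : nat} (j : 'I_n) : 'rV[R]_n :=
  delta_mx 0 j.

Definition bounded_continuous_on {R : realType} {n : nat}
    (O : set 'rV[R]_n) (f : 'rV[R]_n -> R) : Prop :=
  (exists M : R, forall x, O x -> `|f x| <= M) /\
  (forall x, O x -> {for x, continuous f}).

(* For O convex and open, [holder_zygmund O a f] says that the restriction of f
   to O lies in the Hoelder-Zygmund class C^a(O); it depends only on f on O.
   The norm on 'rV[R]_n is the library's sup norm; as all norms are equivalent,
   the classes are those of the Euclidean norm.  The condition that the midpoint
   is in O is vacuous for O convex and only serves to make sense of the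
   definition on an arbitrary open set. *)
Inductive holder_zygmund {R : realType} {n : nat} (O : set 'rV[R]_n) :
    R -> ('rV[R]_n -> R) -> Prop :=
| holder_zygmund_lt1 (a : R) (f : 'rV[R]_n -> R) of
    0 < a < 1 &
    bounded_continuous_on O f &
    (exists M : R, forall x y, O x -> O y -> x != y ->
       `|x - y| `^ (- a) * `|f x - f y| <= M) :
    holder_zygmund O a f
| holder_zygmund_eq1 (f : 'rV[R]_n -> R) of
    bounded_continuous_on O f &
    (exists M : R, forall x y, O x -> O y -> O (2^-1 *: (x + y)) -> x != y ->
       `|x - y|^-1 * `|(f x + f y) / 2 - f (2^-1 *: (x + y))| <= M) :
    holder_zygmund O 1 f
| holder_zygmund_gt1 (a : R) (f : 'rV[R]_n -> R) of
    1 < a &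
    (forall (j : 'I_n) x, O x -> derivable f x (std_basis j)) &
    holder_zygmund O (a - 1) f &
    (forall j : 'I_n, holder_zygmund O (a - 1) ('D_(std_basis j) f)) :
    holder_zygmund O a f.

Definition C1_on {R : realType} {n : nat} {W : normedModType R}
    (O : set 'rV[R]_n) (f : 'rV[R]_n -> W) : Prop :=
  forall x, O x ->
    differentiable f x /\ forall v, {for x, continuous ('D_v f)}.

Definition C0_on {R : realType} {n : nat} {W : normedModType R}
    (O : set 'rV[R]_n) (f : 'rV[R]_n -> W) : Prop :=
  forall x, O x -> {for x, continuous f}.

(* Complex vector fields on R^3 in the frame d/dx_1, d/dx_2, d/dx_3: the fibres
   of the complexified tangent bundle are identified with C^3. *)
Definition cfield (R : realType) : Type := 'rV[R]_3 -> 'rV[R[i]]_3.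

Definition componentwise {R : realType}
    (P : ('rV[R]_3 -> R) -> Prop) (X : cfield R) : Prop :=
  forall j : 'I_3, P (fun p => complex.Re (X p 0 j)) /\
                   P (fun p => complex.Im (X p 0 j)).

Definition cpartial {R : realType} (i : 'I_3) (f : 'rV[R]_3 -> R[i])
    (p : 'rV[R]_3) : R[i] :=
  'D_(std_basis i) (fun q => complex.Re (f q)) p +i*
  'D_(std_basis i) (fun q => complex.Im (f q)) p.

Definition lie_bracket {R : realType} (X Y : cfield R) : cfield R :=
  fun p => \row_j \sum_(i < 3)
    (X p 0 i * cpartial i (fun q => Y q 0 j) p -
     Y p 0 i * cpartial i (fun q => X q 0 j) p).

(* A subset of CTR^3 all of whose fibres are complex linear subspaces. *)
Definition cdistribution (R : realType) : Type :=
  'rV[R]_3 -> {vspace 'rV[R[i]]_3}.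

Definition conjv {R : realType} (v : 'rV[R[i]]_3) : 'rV[R[i]]_3 :=
  map_mx conjc v.

Definition conj_vspace {R : realType} (U : {vspace 'rV[R[i]]_3}) :
    {vspace 'rV[R[i]]_3} :=
  <<[seq conjv v | v <- vbasis U]>>%VS.

Lemma conjvK {R : realType} : involutive (@conjv R).
Proof. by move=> v; apply/rowP => j; rewrite !mxE conjcK. Qed.

Lemma mem_conj_vspace {R : realType} (U : {vspace 'rV[R[i]]_3}) v :
  (v \in conj_vspace U) = (conjv v \in U).
Proof.
have conjvD (I : finType) (F : I -> 'rV[R[i]]_3) (c : I -> R[i]) :
    conjv (\sum_i c i *: F i) = \sum_i (c i)^* *: conjv (F i).
  apply/rowP => j; rewrite mxE !summxE rmorph_sum.
  by apply: eq_bigr => i _; rewrite !mxE rmorphM.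
rewrite /conj_vspace; apply/idP/idP.
- rewrite -[X in <<X>>%VS]/(tval (map_tuple conjv (vbasis U))) => vU.
  rewrite (coord_span vU) conjvD.
  apply: memv_suml => i _; rewrite memvZ // -tnth_nth tnth_map conjvK.
  by rewrite vbasis_mem // mem_tnth.
- move=> vU; rewrite -[v]conjvK (coord_vbasis vU) conjvD.
  apply: memv_suml => i _; rewrite memvZ // memv_span // map_f //.
  by rewrite mem_nth // size_tuple.
Qed.

Definition conj_bundle {R : realType} (S : cdistribution R) : cdistribution R :=
  fun p => conj_vspace (S p).

Definition add_bundle {R : realType} (S T : cdistribution R) :
    cdistribution R :=
  fun p => (S p + T p)%VS.

Definition has_rank {R : realType} (k : nat) (S : cdistribution R) : Prop :=
  forall p, \dim (S p) = k.

Definition tangent_subbundle {R : realType} (a : R) (k : nat)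
    (S : cdistribution R) : Prop :=
  has_rank k S /\
  forall p, exists2 e : R, 0 < e &
    exists X : 'I_k -> cfield R,
      (forall i, componentwise (holder_zygmund (ball p e) a) (X i)) /\
      (forall q, ball p e q -> basis_of (S q) [seq X i q | i : 'I_k]).

Definition section_on {R : realType} (O : set 'rV[R]_3) (S : cdistribution R)
    (X : cfield R) : Prop :=
  forall p, O p -> X p \in S p.

Definition involutive_bundle {R : realType} (S : cdistribution R) : Prop :=
  forall (O : set 'rV[R]_3) (X Y : cfield R), open O ->
    componentwise (C1_on O) X -> section_on O S X ->
    componentwise (C1_on O) Y -> section_on O S Y ->
    componentwise (C0_on O) (lie_bracket X Y) /\
    section_on O S (lie_bracket X Y).

(* S + conj S is spanned by finitely many C^a fields, so as soon as it is a
   subbundle of any regularity it is a C^a one. *)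
Definition frobenius_structure {R : realType} (a : R) (S : cdistribution R) :
    Prop :=
  let SS := add_bundle S (conj_bundle S) in
  [/\ exists k, tangent_subbundle a k S,
      exists k, tangent_subbundle a k SS,
      involutive_bundle S &
      involutive_bundle SS].

(* The target C_z x R_s of a chart is identified with R^3 by
   (z, s) = (x + iy, s) |-> (x, y, s). *)
Definition C1_chart {R : realType} (U : set 'rV[R]_3)
    (F Phi : 'rV[R]_3 -> 'rV[R]_3) : Prop :=
  [/\ open U, open (F @` U), (forall p, U p -> Phi (F p) = p),
      C1_on U F & C1_on (F @` U) Phi].

Definition dz {R : realType} (Phi : 'rV[R]_3 -> 'rV[R]_3) : cfield R :=
  let ix : 'I_3 := inord 0 in
  let iy : 'I_3 := inord 1 in
  fun w => 2^-1 *: (map_mx (real_complex R) ('D_(std_basis ix) Phi w) -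
                    (0 +i* 1) *: map_mx (real_complex R) ('D_(std_basis iy) Phi w)).

Definition pullback_dz {R : realType} (F Phi : 'rV[R]_3 -> 'rV[R]_3) :
    cfield R :=
  fun p => dz Phi (F p).

(* Main.v *)
Require Import Defs.
From HB Require Import structures.
From mathcomp Require Import all_boot all_order all_algebra.
From mathcomp Require Import complex.
From mathcomp Require Import all_classical all_reals all_analysis.
From mathcomp Require Import ring lra.
Import Order.TTheory GRing.Theory Num.Theory.
Import numFieldNormedType.Exports.
Local Open Scope classical_set_scope.
Local Open Scope ring_scope.

Set Implicit Arguments.
Unset Strict Implicit.
Unset Printing Implicit Defensive.

(** On R^3 with coordinates x, y, s, let s_+ = max(s, 0) and let S be spanned by
    Z = d/dx + (r + i) d/dy with r = s_+^a y^2 / (x^2 + y^2 + s^2) real.  Then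
    S + conj S is spanned by d/dx and d/dy ([mem_leaf_sum]), whence the Frobenius
    conditions ([leaf_bundle_frobenius]); r has class C^a since its derivatives
    of order k are O(s_+^(a - k)) ([plane_class_holder_zygmund]).

    Suppose that F^* d/dz = h Z has class C^a.  As d/dz commutes with its
    conjugate, h_x + (r - i) h_y = r_y h ([chart_equations]).  For s <= 0 the
    coefficient r vanishes and h is antiholomorphic in x + i y.  For s > 0 take
    the m-th backward difference v of h with step s, in the direction of s, at
    the level s: the other nodes lie at levels at most 0, so v differs from
    h(., s) by an antiholomorphic function, and v_x - i v_y = r_y h - r h_y.
    When m is large v is O(s^a) ([holder_zygmund_bdiff]); finite differences are
    used instead of a Taylor expansion because for integral a the latter would
    lose the very logarithm which is sought.

    On the other hand r_y h - r h_y = r_y h(0) + O(s^a), and on the circle of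
    radius R >= s the integral of sin(t) r_y has order s^a / R.  Integrating the
    equation for v in polar coordinates over s <= R <= R_0, the angular
    derivatives disappear and the circular mean of a component of v varies by an
    order of at least s^a log(R_0 / s) ([polar_log_bound]).  This contradicts
    v = O(s^a) as s tends to 0 ([obstruction_level], [obstruction]). *)

(** * Differential calculus in several variables *)

Lemma coord_le_norm {R : realType} {n : nat} (v : 'rV[R]_n) (j : 'I_n) :
  `|v 0 j| <= `|v|.
Proof.
rewrite [leRHS]mx_normrE.
by rewrite (@le_bigmax _ _ _ 0 (fun ij => `|v ij.1 ij.2|) (0, j)).
Qed.

Lemma norm_le_coord {R : realType} {n : nat} (v : 'rV[R]_n) (e : R) :
  0 <= e -> (forall j, `|v 0 j| <= e) -> `|v| <= e.
Proof.
move=> e0 H; rewrite [leLHS]mx_normrE.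
by apply/bigmax_leP; split => // -[i j] _ /=; rewrite (ord1 i).
Qed.

Lemma is_derive_line {R : realType} {V W : normedModType R} (f : V -> W)
    (p v : V) (t : R) (l : W) :
  is_derive (p + t *: v) v f l -> is_derive t 1 (fun u : R => f (p + u *: v)) l.
Proof.
move=> [df <-]; have E : (fun h : R => h^-1 *:
    (((fun u : R => f (p + u *: v)) \o shift t) (h *: 1) -
     (fun u : R => f (p + u *: v)) t)) =
    (fun h : R => h^-1 *: ((f \o shift (p + t *: v)) (h *: v) - f (p + t *: v))).
  apply/funext => h /=; congr (_ *: (f _ - _)).
  by rewrite scaler1 scalerDl addrCA.
by apply: DeriveDef; rewrite /derivable /derive E.
Qed.

Lemma norm_le_minmax {R : realDomainType} (t u : R) :
  Num.min 0 t <= u <= Num.max 0 t -> `|u| <= `|t|.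
Proof.
by case: (leP 0 t) => t0 /andP[]; rewrite ler_norml;
   [rewrite ger0_norm //|rewrite ltr0_norm //] => *; apply/andP; split; lra.
Qed.

Lemma is_derive_translate {R : realType} {V W : normedModType R} (f : V -> W)
    (p c v : V) (l : W) :
  is_derive (p + c) v f l -> is_derive p v (fun q => f (q + c)) l.
Proof.
move=> [df <-]; have E : (fun h : R => h^-1 *:
    (((fun q => f (q + c)) \o shift p) (h *: v) - f (p + c))) =
    (fun h : R => h^-1 *: ((f \o shift (p + c)) (h *: v) - f (p + c))).
  by apply/funext => h /=; rewrite addrA.
by apply: DeriveDef; rewrite /derivable /derive E.
Qed.

(** The mean value theorem along a line, for a parameter [t] of either sign. *)
Lemma MVT_dir {R : realType} {V : normedModType R} (f : V -> R) (df : V -> R)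
    (p v : V) (t : R) :
  (forall u, Num.min 0 t <= u <= Num.max 0 t ->
     is_derive (p + u *: v) v f (df (p + u *: v))) ->
  exists2 u, Num.min 0 t <= u <= Num.max 0 t &
    f (p + t *: v) - f p = t * df (p + u *: v).
Proof.
move=> H; pose g u := f (p + u *: v).
have dg u : Num.min 0 t <= u <= Num.max 0 t ->
    is_derive u 1 g (df (p + u *: v)).
  by move=> /H; exact: is_derive_line.
have cg a b : `[a, b] `<=` `[Num.min 0 t, Num.max 0 t] ->
    {within `[a, b], continuous g}.
  move=> ab; apply: derivable_within_continuous => u uab.
  by have /dg[] : Num.min 0 t <= u <= Num.max 0 t by have := ab u uab; rewrite /= in_itv.
have [t0|t0] := leP 0 t.
- rewrite min_l // max_r // in H dg cg *.
  have [||u] := @MVT_segment _ g (fun u => df (p + u *: v)) 0 t t0.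
  + by move=> u; rewrite in_itv /= => /andP[u0 ut]; apply: dg; rewrite !ltW.
  + exact: cg.
  rewrite in_itv /= => u0t; rewrite /g scale0r addr0 subr0 => ->.
  by exists u => //; rewrite mulrC.
- rewrite min_r ?ltW // max_l ?ltW // in H dg cg *.
  have [||u] := @MVT_segment _ g (fun u => df (p + u *: v)) t 0 (ltW t0).
  + by move=> u; rewrite in_itv /= => /andP[u0 ut]; apply: dg; rewrite !ltW.
  + exact: cg.
  rewrite in_itv /= => u0t; rewrite /g scale0r addr0 sub0r => E.
  by exists u => //; rewrite -opprB E mulrN opprK mulrC.
Qed.

Lemma row_std_basis {R : realType} {n : nat} (v : 'rV[R]_n) :
  v = \sum_j v 0 j *: std_basis j.
Proof. exact: row_sum_delta. Qed.

(** The linear form with coefficients [c], the candidate differential below. *)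
Definition linear_form {R : realType} {n : nat} (c : 'I_n -> R) (h : 'rV[R]_n) : R
  := \sum_j h 0 j * c j.

Lemma linear_form_linear {R : realType} {n : nat} (c : 'I_n -> R) :
  linear (linear_form c).
Proof.
move=> a u v; rewrite /linear_form scaler_sumr -big_split /=.
by apply: eq_bigr => j _; rewrite !mxE mulrDl -mulrA.
Qed.
HB.instance Definition _ {R : realType} {n : nat} (c : 'I_n -> R) :=
  GRing.isLinear.Build R 'rV[R]_n R _ (linear_form c) (linear_form_linear c).

Lemma continuous_linear_form {R : realType} {n : nat} (c : 'I_n -> R) :
  continuous (linear_form c).
Proof.
move=> x; apply: differentiable_continuous; rewrite /linear_form.
have -> : (fun h : 'rV[R]_n => \sum_j h 0 j * c j) =
    \sum_j (fun h : 'rV[R]_n => h 0 j * c j) by apply/funext => h; rewrite fct_sumE.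
apply: differentiable_sum => j; apply: differentiableM => //.
exact: differentiable_coord.
Qed.

(** A function whose partial derivatives exist near a point and are continuous
    there is Frechet differentiable there. *)
Lemma differentiable_partials {R : realType} {n : nat} (f : 'rV[R]_n -> R)
    (p : 'rV[R]_n) :
  (forall j, \forall q \near p, derivable f q (std_basis j)) ->
  (forall j, {for p, continuous ('D_(std_basis j) f)}) ->
  differentiable f p.
Proof.
move=> df cf; pose c j := 'D_(std_basis j) f p.
suff E : f \o shift p = cst (f p) + linear_form c +o_ (0 : 'rV[R]_n) id.
  have dE := diff_unique (@continuous_linear_form _ _ c) E.
  by apply/diff_locallyP; rewrite dE; split => //; exact: continuous_linear_form.
apply/eqaddoP => e e0.
have n1 : 0 < (n.+1%:R : R) by [].
have en : 0 < e / n.+1%:R by rewrite divr_gt0.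
(* a ball on which every partial derivative is within e / (n + 1) of its value at p *)
have [d d0 Hd] : exists2 d, 0 < d & forall j q, ball p d q ->
    derivable f q (std_basis j) /\ `|'D_(std_basis j) f q - c j| <= e / n.+1%:R.
  have H : \forall q \near p, forall j,
      derivable f q (std_basis j) /\ `|'D_(std_basis j) f q - c j| <= e / n.+1%:R.
    near=> q; near: q; apply: filter_forall => j; near=> q; split; first by near: q; exact: df.
    rewrite distrC; near: q; move: (cf j) => /cvgrPdist_le; exact.
  by have /nbhs_ballP[d /= d0 Hd] := H; exists d => // j q /Hd.
have : nbhs (0 : 'rV[R]_n) (ball 0 d) by apply/nbhs_ballP; exists d.
apply: filterS => h; rewrite -ball_normE /= sub0r normrN => hd.
pose tr k : 'rV[R]_n := \row_i (if (i < k)%N then h 0 i else 0).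
have trS (k : 'I_n) : tr k.+1 = tr k + h 0 k *: std_basis k.
  apply/rowP => i; rewrite !mxE eqxx /= ltnS leq_eqVlt.
  case: (ltngtP i k) => [ik|ik|/val_inj ->] /=.
  - by rewrite (negbTE (_ : i != k)) ?mulr0 ?addr0 // neq_ltn ik.
  - by rewrite (negbTE (_ : i != k)) ?mulr0 ?addr0 // neq_ltn ik orbT.
  - by rewrite eqxx mulr1 add0r.
have tr0 : tr 0%N = 0 by apply/rowP => i; rewrite !mxE.
have trn : tr n = h by apply/rowP => i; rewrite !mxE ltn_ord.
have inb (k : 'I_n) u : Num.min 0 (h 0 k) <= u <= Num.max 0 (h 0 k) ->
    ball p d (p + tr k + u *: std_basis k).
  move=> uk; rewrite -ball_normE /= -addrA opprD addrA subrr sub0r normrN.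
  apply: le_lt_trans hd; apply: norm_le_coord => // i; rewrite !mxE eqxx /=.
  have [->|ik] := eqVneq i k.
    rewrite ltnn add0r mulr1; apply: le_trans (coord_le_norm h k).
    exact: norm_le_minmax.
  rewrite mulr0 addr0; case: ifP => _; first exact: coord_le_norm.
  by rewrite normr0.
have step (k : 'I_n) : `|f (p + tr k.+1) - f (p + tr k) - h 0 k * c k|
    <= `|h| * (e / n.+1%:R).
  rewrite trS addrA.
  have [u /inb uk ->] := @MVT_dir _ _ f ('D_(std_basis k) f) (p + tr k)
      (std_basis k) (h 0 k) (fun u uk => derivableP (Hd k _ (inb k u uk)).1).
  rewrite -mulrBr normrM ler_pM ?coord_le_norm //.
  exact: (Hd k _ uk).2.
have -> : (f \o shift p - (cst (f p) + linear_form c)) h =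
    \sum_(k < n) (f (p + tr k.+1) - f (p + tr k) - h 0 k * c k).
  rewrite sumrB -(big_mkord xpredT (fun k => f (p + tr k.+1) - f (p + tr k))).
  rewrite telescope_sumr // trn tr0 addr0.
  by rewrite !fctE /= opprD addrA (addrC h).
apply: le_trans (ler_norm_sum _ _ _) _.
apply: (@le_trans _ _ (\sum_(k < n) `|h| * (e / n.+1%:R))); first exact: ler_sum.
rewrite sumr_const card_ord -[_ *+ n]mulr_natr -mulrA [leRHS]mulrC ler_wpM2l //.
by rewrite mulrAC ler_pdivrMr // ler_pM2l // ler_nat.
Unshelve. all: by end_near. Qed.

Lemma derive_partials {R : realType} {n : nat} (f : 'rV[R]_n -> R)
    (p v : 'rV[R]_n) : differentiable f p ->
  'D_v f p = \sum_j v 0 j * 'D_(std_basis j) f p.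
Proof.
move=> df; rewrite deriveE // {1}(row_std_basis v) linear_sum /=.
by apply: eq_bigr => j _; rewrite linearZ /= deriveE.
Qed.

Lemma is_derive_comp_row {R : realType} {V : normedModType R} {n : nat}
    (f : 'rV[R]_n -> R) (g : V -> 'rV[R]_n) (x v : V) (g' : 'rV[R]_n) :
  differentiable f (g x) -> differentiable g x -> 'D_v g x = g' ->
  is_derive x v (f \o g) (\sum_j g' 0 j * 'D_(std_basis j) f (g x)).
Proof.
move=> df dg <-; apply: DeriveDef.
  exact/diff_derivable/differentiable_comp.
have E : 'D_v (f \o g) x = 'd f (g x) ('d g x v).
  by rewrite (deriveE _ (differentiable_comp dg df)) (diff_comp dg df).
by rewrite E -(deriveE _ dg) -(deriveE _ df) (derive_partials _ df).
Qed.

(** Equality of mixed derivatives in two directions, only the first derivatives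
    and the two mixed ones being required to exist. *)
Lemma derive_comm {R : realType} {V : normedModType R} (f : V -> R)
    (p u v : V) :
  (\forall q \near p, derivable f q u /\ derivable f q v /\
     derivable ('D_u f) q v /\ derivable ('D_v f) q u) ->
  {for p, continuous ('D_v ('D_u f))} -> {for p, continuous ('D_u ('D_v f))} ->
  'D_v ('D_u f) p = 'D_u ('D_v f) p.
Proof.
move=> /nbhs_ballP[d /= d0 Hd] cvu cuv.
apply/eqP; rewrite -subr_eq0 -normr_eq0; apply/eqP/le_anti.
rewrite normr_ge0 andbT; apply/ler_addgt0Pl => e e0; rewrite addr0.
have e2 : 0 < e / 2 by rewrite divr_gt0.
have /nbhs_ballP[d1 /= d10 H1] : \forall q \near p, `|'D_v ('D_u f) p - 'D_v ('D_u f) q| <= e / 2.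
  by move: cvu => /cvgrPdist_le; exact.
have /nbhs_ballP[d2 /= d20 H2] : \forall q \near p, `|'D_u ('D_v f) p - 'D_u ('D_v f) q| <= e / 2.
  by move: cuv => /cvgrPdist_le; exact.
pose N := `|u| + `|v| + 1.
have N0 : 0 < N by rewrite ltr_wpDl // addr_ge0.
pose m := Num.min d (Num.min d1 d2).
have m0 : 0 < m by rewrite !lt_min d0 d10 d20.
pose t := m / (2 * N).
have t0 : 0 < t by rewrite divr_gt0 // mulr_gt0.
have inb a b : 0 <= a <= t -> 0 <= b <= t -> ball p m (p + a *: u + b *: v).
  move=> /andP[a0 at_] /andP[b0 bt].
  rewrite -ball_normE /= -addrA opprD addrA subrr sub0r normrN.
  apply: le_lt_trans (ler_normD _ _) _; rewrite !normrZ !ger0_norm //.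
  apply: (@le_lt_trans _ _ (t * `|u| + t * `|v|)).
    by rewrite lerD // ler_wpM2r.
  rewrite -mulrDr /t mulrAC ltr_pdivrMr ?mulr_gt0 // ltr_pM2l //.
  by rewrite /N; have := normr_ge0 u; have := normr_ge0 v; lra.
have sub q : ball p m q -> [/\ ball p d q, ball p d1 q & ball p d2 q].
  by move=> mq; split; apply: le_ball mq; rewrite /m !ge_min lexx ?orbT.
have D a b : 0 <= a <= t -> 0 <= b <= t ->
    let q := p + a *: u + b *: v in
    [/\ is_derive q u f ('D_u f q), is_derive q v f ('D_v f q),
        is_derive q v ('D_u f) ('D_v ('D_u f) q) &
        is_derive q u ('D_v f) ('D_u ('D_v f) q)].
  move=> ha hb q; have [/Hd [? [? [? ?]]] _ _] := sub q (inb _ _ ha hb).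
  by split; exact: derivableP.
have tt : Num.min 0 t = 0 /\ Num.max 0 t = t.
  by split; [rewrite min_l // ltW | rewrite max_r // ltW].
have t00 : (0 : R) <= 0 <= t by rewrite lexx ltW.
have t0t : 0 <= t <= t by rewrite lexx ltW.
(* the second difference over the parallelogram, computed in either order *)
have sd1 (w x y z : R) : w - x - y + z = w - x - (y - z) by lra.
have sd2 (w x y z : R) : w - x - y + z = w - y - (x - z) by lra.
pose S := f (p + t *: u + t *: v) - f (p + t *: u) - f (p + t *: v) + f p.
have [a [b [ha hb SE]]] : exists a b, [/\ 0 <= a <= t, 0 <= b <= t &
    S = t * (t * 'D_v ('D_u f) (p + a *: u + b *: v))].
  have [|a ha E] := @MVT_dir _ _ (fun q => f (q + t *: v) - f q)
    (fun q => 'D_u f (q + t *: v) - 'D_u f q) p u t.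
    move=> a; rewrite !tt.1 !tt.2 => ha; apply: is_deriveB.
      by have [+ _ _ _] := D a t ha t0t; exact: is_derive_translate.
    by have [+ _ _ _] := D a 0 ha t00; rewrite scale0r addr0.
  move: ha; rewrite tt.1 tt.2 => ha.
  have [|b hb E'] := @MVT_dir _ _ ('D_u f) ('D_v ('D_u f)) (p + a *: u) v t.
    by move=> b; rewrite !tt.1 !tt.2 => hb; have [_ _ + _] := D a b ha hb.
  move: hb; rewrite tt.1 tt.2 => hb.
  exists a, b; split; [exact: ha|exact: hb|].
  transitivity (t * ('D_u f (p + a *: u + t *: v) - 'D_u f (p + a *: u))).
    by apply: etrans E; exact: sd1.
  by congr (t * _); exact: E'.
have [a' [b' [ha' hb' SE']]] : exists a b, [/\ 0 <= a <= t, 0 <= b <= t &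
    S = t * (t * 'D_u ('D_v f) (p + a *: u + b *: v))].
  have [|b1 hb1 E] := @MVT_dir _ _ (fun q => f (q + t *: u) - f q)
    (fun q => 'D_v f (q + t *: u) - 'D_v f q) p v t.
    move=> b1; rewrite !tt.1 !tt.2 => hb1; apply: is_deriveB.
      apply: is_derive_translate; rewrite addrAC.
      by have [] := D t b1 t0t hb1.
    by have [_ + _ _] := D 0 b1 t00 hb1; rewrite scale0r addr0.
  move: hb1; rewrite tt.1 tt.2 => hb1.
  have [|a1 ha1 E'] := @MVT_dir _ _ ('D_v f) ('D_u ('D_v f)) (p + b1 *: v) u t.
    move=> a1; rewrite !tt.1 !tt.2 => ha1; rewrite addrAC.
    by have [_ _ _ +] := D a1 b1 ha1 hb1.
  move: ha1; rewrite tt.1 tt.2 => ha1.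
  exists a1, b1; split; [exact: ha1|exact: hb1|].
  have Eab : p + a1 *: u + b1 *: v = p + b1 *: v + a1 *: u by rewrite addrAC.
  have Ett : p + t *: u + t *: v = p + t *: v + t *: u by rewrite addrAC.
  rewrite Eab; transitivity (t * ('D_v f (p + b1 *: v + t *: u) - 'D_v f (p + b1 *: v))).
    by apply: etrans E; rewrite /S Ett; exact: sd2.
  by congr (t * _); exact: E'.
have Eq : 'D_v ('D_u f) (p + a *: u + b *: v) =
    'D_u ('D_v f) (p + a' *: u + b' *: v).
  apply: (mulfI (lt0r_neq0 t0)); apply: (mulfI (lt0r_neq0 t0)).
  exact: etrans (esym SE) SE'.
have [_ B1 _] := sub _ (inb _ _ ha hb).
have [_ _ B2] := sub _ (inb _ _ ha' hb').
have h1 := H1 _ B1; have h2 := H2 _ B2; rewrite Eq in h1.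
apply: le_trans (ler_distD _ _ _) _; last rewrite (splitr e); apply: lerD.
  exact: h1.
by rewrite distrC; exact: h2.
Qed.

(** * Hoelder-Zygmund classes and backward differences *)

Section holder_zygmund_facts.
Context {R : realType} {n : nat}.
Implicit Types (O : set 'rV[R]_n) (f g : 'rV[R]_n -> R) (a : R).

Lemma holder_zygmund_bounded O a f :
  holder_zygmund O a f -> bounded_continuous_on O f.
Proof. by elim. Qed.

Lemma holder_zygmund_inv O a f : 1 < a -> holder_zygmund O a f ->
  [/\ forall j x, O x -> derivable f x (std_basis j),
      holder_zygmund O (a - 1) f &
      forall j, holder_zygmund O (a - 1) ('D_(std_basis j) f)].
Proof.
move=> a1 H; case: H a1 => [b g /andP[_ b1] _ _|g _ _|b g b1 H1 H2 H3] a1 //.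
  by have := lt_trans a1 b1; rewrite ltxx.
by rewrite ltxx in a1.
Qed.

Lemma holder_zygmund_differentiable O a f : open O -> 1 < a ->
  holder_zygmund O a f -> forall x, O x -> differentiable f x.
Proof.
move=> oO a1 /(holder_zygmund_inv a1)[df _ Hf] x Ox.
apply: differentiable_partials => j.
  by near=> q; apply: df; near: q; exact: open_nbhs_nbhs.
by have [_] := holder_zygmund_bounded (Hf j); exact.
Unshelve. all: by end_near. Qed.

Lemma holder_zygmund_partial_continuous O a f j : 1 < a ->
  holder_zygmund O a f ->
  forall x, O x -> {for x, continuous ('D_(std_basis j) f)}.
Proof.
by move=> a1 /(holder_zygmund_inv a1)[_ _ /(_ j)/holder_zygmund_bounded[]].
Qed.

Lemma holder_zygmund_cst O a (c : R) : 0 < a -> holder_zygmund O a (cst c).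
Proof.
have bc (d : R) : bounded_continuous_on O (cst d).
  by split; [exists `|d| | move=> x _; exact: cst_continuous].
move: c => c0 a0; have [k ak] : exists k, a <= k%:R.
  by exists (Num.truncn a).+1; rewrite ltW // truncnS_gt.
elim: k a a0 ak c0 => [a a0 /(lt_le_trans a0)|k IH a a0 ak c]; first by rewrite ltxx.
have [a1|a1|->] := ltgtP a 1.
- apply: holder_zygmund_lt1; rewrite ?a0 //; exists 0 => x y _ _ _.
  by rewrite /cst subrr normr0 mulr0.
- have a10 : 0 < a - 1 by rewrite subr_gt0.
  have ak1 : a - 1 <= k%:R by rewrite lerBlDr natr1.
  apply: holder_zygmund_gt1 => //; first by apply: IH.
  move=> j; have -> : 'D_(std_basis j) (cst c : 'rV[R]_n -> R) = cst 0.
    by apply/funext => x; rewrite derive_cst.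
  exact: IH.
- apply: holder_zygmund_eq1 => //; exists 0 => x y _ _ _ _.
  by rewrite /cst -mulr2n -[c *+ 2]mulr_natr mulfK // subrr normr0 mulr0.
Qed.

End holder_zygmund_facts.

(** The [m]-th backward difference of [f] with step [h] in the direction [e]. *)
Fixpoint bdiff {R : realType} {V : lmodType R} (e : V) (m : nat) (h : R)
    (f : V -> R) (p : V) : R :=
  if m is m'.+1 then bdiff e m' h f p - bdiff e m' h f (p - h *: e) else f p.

Section bdiff_facts.
Context {R : realType} {V : normedModType R} (e : V).
Implicit Types (f g : V -> R) (h : R) (m : nat).

Lemma bdiff_shift h j p :
  p - h *: e - (j%:R * h) *: e = p - (j.+1%:R * h) *: e.
Proof.
rewrite -addrA -opprD -scalerDl -natr1; congr (p - _ *: e).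
by rewrite mulrDl mul1r addrC.
Qed.

(** If [f] vanishes at all the nodes but the first one, the difference reduces
    to the value at that node. *)
Lemma bdiff_vanish m h f p :
  (forall j, (0 < j <= m)%N -> f (p - (j%:R * h) *: e) = 0) ->
  bdiff e m h f p = f p.
Proof.
have van0 k q : (forall j, (j <= k)%N -> f (q - (j%:R * h) *: e) = 0) ->
    bdiff e k h f q = 0.
  elim: k q => [|k IH] q H /=.
    by have := H 0%N isT; rewrite mul0r scale0r subr0.
  rewrite !IH ?subrr // => j jk; last by apply: H; exact: leqW.
  rewrite bdiff_shift.
  exact: H.
elim: m => [//|m IH] H /=; rewrite IH; last first.
  by move=> j /andP[j0 jm]; apply: H; rewrite j0 leqW.
rewrite van0 ?subr0 // => j jm.
by rewrite bdiff_shift H.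
Qed.

Lemma bdiffD m h f g p :
  bdiff e m h (fun q => f q + g q) p = bdiff e m h f p + bdiff e m h g p.
Proof. by elim: m p => [//|m IH] p /=; rewrite !IH opprD addrACA. Qed.

Lemma bdiffB m h f g p :
  bdiff e m h (fun q => f q - g q) p = bdiff e m h f p - bdiff e m h g p.
Proof. elim: m p => [//|m IH] p /=; rewrite !IH; ring. Qed.

Lemma bdiff_le m h f p M :
  (forall j, (j <= m)%N -> `|f (p - (j%:R * h) *: e)| <= M) ->
  `|bdiff e m h f p| <= 2 ^+ m * M.
Proof.
elim: m p => [|m IH] p H /=.
  by have := H 0%N isT; rewrite mul0r scale0r subr0 expr0 mul1r.
apply: le_trans (ler_normB _ _) _; rewrite exprS -mulrA mulrDl mul1r.
rewrite lerD // IH // => j jm; first by apply: H; exact: leqW.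
by rewrite bdiff_shift H.
Qed.

Lemma is_derive_bdiff m h f (df : V -> R) p v :
  (forall j, (j <= m)%N ->
     is_derive (p - (j%:R * h) *: e) v f (df (p - (j%:R * h) *: e))) ->
  is_derive p v (bdiff e m h f) (bdiff e m h df p).
Proof.
elim: m p => [|m IH] p H /=.
  by have := H 0%N isT; rewrite mul0r scale0r subr0.
apply: is_deriveB; first by apply: IH => j jm; apply: H; exact: leqW.
apply: (is_derive_translate (c := - (h *: e))); apply: IH => j jm.
by rewrite bdiff_shift; apply: H.
Qed.

Lemma continuous_bdiff m h f p :
  (forall j, (j <= m)%N -> {for p - (j%:R * h) *: e, continuous f}) ->
  {for p, continuous (bdiff e m h f)}.
Proof.
elim: m p => [|m IH] p H /=.
  by have := H 0%N isT; rewrite mul0r scale0r subr0.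
apply: (@continuousB _ _ _ (bdiff e m h f)
   (fun q => bdiff e m h f (q - h *: e)) p).
  by apply: IH => j jm; apply: H; exact: leqW.
apply: (@continuous_comp _ _ _ (fun q => q - h *: e) (bdiff e m h f)).
  by apply: (@continuousB _ _ _ id (cst (h *: e))); [exact: cvg_id|exact: cst_continuous].
apply: IH => j jm.
by rewrite bdiff_shift; apply: H.
Qed.

Lemma differentiable_bdiff m h f p :
  (forall j, (j <= m)%N -> differentiable f (p - (j%:R * h) *: e)) ->
  differentiable (bdiff e m h f) p.
Proof.
elim: m p => [|m IH] p H /=.
  by have := H 0%N isT; rewrite mul0r scale0r subr0.
apply: (@differentiableB _ _ _ (bdiff e m h f)
   (fun q => bdiff e m h f (q - h *: e)) p).
  by apply: IH => j jm; apply: H; exact: leqW.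
apply: (@differentiable_comp _ _ _ _ (fun q => q - h *: e) (bdiff e m h f)).
  by apply: (@differentiableB _ _ _ id (cst (h *: e))).
apply: IH => j jm.
by rewrite bdiff_shift; apply: H.
Qed.

End bdiff_facts.

(** High order differences of a function of class C^a are O(h^a), also for
    integral [a], where Taylor expansions are only precise up to a logarithm. *)
Lemma holder_zygmund_bdiff {R : realType} {n : nat} (O : set 'rV[R]_n) (a : R)
    (f : 'rV[R]_n -> R) (i : 'I_n) : holder_zygmund O a f ->
  exists m0, forall m, (m0 <= m)%N -> exists C : R, forall p h, 0 < h ->
    (forall t, 0 <= t <= m%:R * h -> O (p - t *: std_basis i)) ->
    `|bdiff (std_basis i) m h f p| <= C * h `^ a.
Proof.
set e : 'rV[R]_n := std_basis i.
have ne : `|e| = 1.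
  apply/le_anti/andP; split.
    by apply: norm_le_coord => // j; rewrite mxE /=; case: (j == i); rewrite ?normr1 ?normr0.
  by apply: le_trans (coord_le_norm e i); rewrite mxE !eqxx normr1.
have e0 : e != 0 by rewrite -normr_eq0 ne oner_eq0.
(* a bound for one order entails one for all higher orders *)
have up (g : 'rV[R]_n -> R) b m0 :
    (exists C : R, forall p h, 0 < h ->
      (forall t, 0 <= t <= m0%:R * h -> O (p - t *: e)) ->
      `|bdiff e m0 h g p| <= C * h `^ b) ->
    forall m, (m0 <= m)%N -> exists C : R, forall p h, 0 < h ->
      (forall t, 0 <= t <= m%:R * h -> O (p - t *: e)) ->
      `|bdiff e m h g p| <= C * h `^ b.
  move=> H; elim=> [|m IH] m0m; first by move: m0m H; rewrite leqn0 => /eqP ->.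
  move: m0m; rewrite leq_eqVlt => /orP[/eqP <- //|]; rewrite ltnS => /IH[C HC].
  exists (2 * C) => p h h0 Op /=; apply: le_trans (ler_normB _ _) _.
  rewrite -mulrA mulr_natl mulr2n lerD // HC // => t /andP[t0 tm].
    by apply: Op; rewrite t0 -natr1 mulrDl mul1r (le_trans tm) // lerDl ltW.
  rewrite -addrA -opprD -scalerDl; apply: Op; rewrite addr_ge0 ?(ltW h0) //=.
  by rewrite -natr1 mulrDl mul1r addrC lerD2r.
elim=> {a f} [a f /andP[a0 a1] _ [M HM]|f _ [M HM]|a f a1 df _ _ _ IH].
- exists 1%N; apply: up; exists M => p h h0 Op /=.
  have xy : p - h *: e != p.
    by rewrite -subr_eq0 addrC addKr oppr_eq0 scaler_eq0 (gt_eqF h0) (negbTE e0).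
  have nE : `|p - (p - h *: e)| = h.
    by rewrite opprB addrCA subrr addr0 normrZ ne mulr1 gtr0_norm.
  have := HM p (p - h *: e); rewrite eq_sym xy nE powRN => /(_ _ _ isT) H.
  rewrite -ler_pdivrMr ?powR_gt0 // mulrC; apply: H.
    by rewrite -[p]subr0 -(scale0r e); apply: Op; rewrite lexx mul1r ltW.
  by apply: Op; rewrite mul1r lexx ltW.
- exists 2%N; apply: up; exists (2 * (2 * M)) => p h h0 Op /=.
  have mid : 2^-1 *: (p + (p - (2 * h) *: e)) = p - h *: e.
    have -> : p + (p - (2 * h) *: e) = 2 *: p - (2 * h) *: e.
      by rewrite addrA scaler_nat mulr2n.
    by rewrite scalerBr !scalerA mulrA mulVf // !(scale1r, mul1r).
  have xy : p != p - (2 * h) *: e.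
    rewrite -subr_eq0 opprB addrCA subrr addr0 scaler_eq0 mulf_eq0 (gt_eqF h0) /=.
    by rewrite pnatr_eq0 (negbTE e0).
  have Ot t : 0 <= t <= 2 * h -> O (p - t *: e) by exact: Op.
  have := HM p (p - (2 * h) *: e); rewrite mid => H.
  have nE : `|p - (p - (2 * h) *: e)| = 2 * h.
    by rewrite opprB addrCA subrr addr0 normrZ ne mulr1 gtr0_norm // mulr_gt0.
  rewrite nE in H.
  have {H} : (2 * h)^-1 * `|(f p + f (p - (2 * h) *: e)) / 2 - f (p - h *: e)| <= M.
    apply: H xy; last by apply: Ot; apply/andP; split; lra.
      by rewrite -[p]subr0 -(scale0r e); apply: Ot; apply/andP; split; lra.
    by apply: Ot; apply/andP; split; lra.
  rewrite mulrC ler_pdivrMr ?mulr_gt0 // => H.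
  have -> : p - h *: e - h *: e = p - (2 * h) *: e.
    by rewrite -addrA -opprD -scalerDl mulr_natl mulr2n.
  rewrite powRr1 ?(ltW h0) //.
  move: H; move: (f p) (f (p - (2 * h) *: e)) (f (p - h *: e)) => x y z H.
  rewrite (_ : x - z - (z - y) = 2 * ((x + y) / 2 - z)); last by lra.
  rewrite normrM ger0_norm // -mulrA ler_pM2l //.
  by apply: le_trans H _; rewrite mulrCA mulrA.
have {IH} [m0 Hm0] := IH i; exists m0.+1; apply: up; have [C HC] := Hm0 _ (leqnn m0).
exists C => p h h0 Op.
have seg u : 0 <= u <= h -> forall t, 0 <= t <= m0%:R * h ->
    O (p - u *: e - t *: e).
  move=> /andP[u0 uh] t /andP[t0 tm]; rewrite -addrA -opprD -scalerDl; apply: Op.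
  by rewrite addr_ge0 //= -natr1 mulrDl mul1r addrC lerD.
have hh : Num.min 0 (- h) = - h /\ Num.max 0 (- h) = 0.
  by split; [rewrite min_r // oppr_le0 ltW | rewrite max_l // oppr_le0 ltW].
have [|u] := @MVT_dir _ _ (bdiff e m0 h f) (bdiff e m0 h ('D_e f)) p e (- h).
  move=> u; rewrite hh.1 hh.2 => hu; apply: is_derive_bdiff => j jm.
  apply/derivableP/df; rewrite -[u]opprK scaleNr; apply: seg.
    by rewrite oppr_ge0 lerNl andbC.
  by rewrite mulr_ge0 ?(ltW h0) //= ler_pM2r // ler_nat.
rewrite hh.1 hh.2 scaleNr => hu E /=; rewrite -normrN opprB E normrM normrN (gtr0_norm h0).
have -> : C * h `^ a = h * (C * h `^ (a - 1)).
  by rewrite [RHS]mulrCA mulr_powRB1 // ?(lt_trans ltr01 a1) // ltW.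
rewrite ler_pM2l // HC // => t ht.
by rewrite -[u]opprK scaleNr; apply: seg ht; rewrite oppr_ge0 lerNl andbC.
Qed.

(** * Growth of circular means *)

(** The function is [sin (4 t) / 4] and its derivative is [cos (4 t)]. *)
Lemma is_derive_sin4 {R : realType} (t : R) :
  is_derive t 1 (fun t : R => sin t * cos t * (cos t ^+ 2 - sin t ^+ 2))
    (1 - 8 * (sin t * cos t) ^+ 2).
Proof.
have hs := is_derive_sin t; have hc := is_derive_cos t.
have H := is_deriveM (is_deriveM hs hc) (is_deriveB (is_deriveM hc hc) (is_deriveM hs hs)).
apply: is_derive_eq H _; rewrite /GRing.scale /= !fctE.
transitivity ((cos t ^+ 2 + sin t ^+ 2) ^+ 2 - 8 * (sin t * cos t) ^+ 2).
  by move: (cos t) (sin t) => c s; ring.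
by rewrite cos2Dsin2 expr1n.
Qed.

(** Along the circles of centre [0], with [q] and [p] functions of the polar
    coordinates: a differential inequality between the radial derivative of
    [q] and the angular derivative of [p], whose circular means vanish, forces a
    logarithmic decay of the circular means of [q].  A bound on [q] thus limits
    the ratio of the radii. *)
Lemma polar_log_bound {R : realType} (u v k C K M : R)
    (q p qr pt : R -> R -> R) :
  0 <= u ->
  (forall r t : R, u < r < v -> is_derive r 1 (q ^~ t) (qr r t)) ->
  (forall r t : R, u < r < v -> is_derive t 1 (p r) (pt r t)) ->
  (forall r : R, u < r < v -> continuous (q r)) ->
  (forall r : R, u < r < v -> continuous (qr r)) ->
  (forall r : R, u < r < v -> continuous (pt r)) ->
  (forall r t : R, u < r < v -> `|qr r t| <= M) ->
  (forall r t : R, u < r < v -> `|q r t| <= K) ->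
  (forall r : R, u < r < v -> p r 0 = p r (pi *+ 2)) ->
  (forall r t : R, u < r < v ->
     qr r t <= - (pt r t / r) - k * (sin t * cos t) ^+ 2 / r + C) ->
  forall a b, u < a -> a <= b -> b < v ->
    k / 8 * (ln b - ln a) <= 2 * K + C * (b - a).
Proof.
move=> u0 dq dp cq cqr cpt bqr bq per ineq a b ua ab bv.
pose T : R := pi *+ 2.
have T0 : 0 < T by rewrite pmulrn_lgt0 // pi_gt0.
pose mu := @lebesgue_measure R.
pose I := `[0 : R, T]%classic.
have mI : measurable I by exact: measurable_itv.
have intI (f : R -> R) : continuous f -> mu.-integrable I (EFin \o f).
  move=> cf; apply: continuous_compact_integrable; first exact: segment_compact.
  by apply: continuous_subspaceT => x; exact: cf.
have muI : fine (mu I) = T.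
  by rewrite /mu /I lebesgue_measure_itv /= lte_fin T0 /= oppr0 addr0.
pose m r := \int[mu]_(t in I) q r t.
have M0 (r t : R) : u < r < v -> 0 <= M by move=> /bqr - /(_ t); exact: le_trans.
have dm (r : R) : u < r < v -> is_derive r 1 m (\int[mu]_(t in I) qr r t).
  move=> urv.
  have qrE (r' t : R) : u < r' < v -> partial1of2 q r' t = qr r' t.
    by move=> h; rewrite partial1of2E; have [_ ->] := dq r' t h.
  have Ir : `]u, v[%classic r by rewrite /= in_itv.
  have H1 x : `]u, v[%classic x -> mu.-integrable I (EFin \o q x).
    by rewrite /= in_itv => /cq; exact: intI.
  have H2 x y : `]u, v[%classic x -> I y -> derivable (q ^~ y) x 1.
    by rewrite /= in_itv => /dq - /(_ y)[].
  have H3 x y : `]u, v[%classic x -> I y -> `|partial1of2 q x y| <= cst M y.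
    by rewrite /= in_itv => h _; rewrite qrE //; exact: bqr.
  have iM : mu.-integrable I (EFin \o cst M) by apply: intI => x; exact: cvg_cst.
  have D := @derivable_under_integral R _ _ mu q I mI r u v Ir H1 H2 (cst M) (fun=> M0 r 0 urv) iM H3.
  have E := @differentiation_under_integral R _ _ mu q I mI r u v Ir H1 H2 (cst M) (fun=> M0 r 0 urv) iM H3.
  apply: DeriveDef; first exact: D.
  rewrite -derive1E; apply: etrans E _.
  by apply: eq_Rintegral => t _; exact: qrE.
have bm (r : R) : u < r < v -> `|m r| <= K * T.
  move=> h; have := @le_normr_Rintegral _ _ R mu I (q r) mI (intI _ (cq r h)).
  move=> /le_trans; apply.
  have -> : K * T = \int[mu]_(t in I) K by rewrite Rintegral_cst // muI.
  apply: le_Rintegral => //.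
  - apply: intI => x; apply: continuous_comp; first exact: cq.
    exact: norm_continuous.
  - by apply: intI => x; exact: cvg_cst.
  - by move=> t _; exact: bq.
have r_gt0 (r : R) : u < r < v -> 0 < r by move=> /andP[ur _]; exact: le_lt_trans ur.
(* [(sin * cos) ^ 2] is [1 / 8] plus a derivative, which is added to that of [p] *)
pose G (r t : R) := p r t + k / 8 * (t - sin t * cos t * (cos t ^+ 2 - sin t ^+ 2)).
pose g (r t : R) := pt r t + k * (sin t * cos t) ^+ 2.
have dG (r t : R) : u < r < v -> is_derive t 1 (G r) (g r t).
  move=> /dp - /(_ t) dpt.
  have H := is_deriveD dpt (is_deriveZ (k / 8)
    (is_deriveB (is_derive_id t 1) (is_derive_sin4 t))).
  apply: is_derive_eq H _; rewrite /g; congr (_ + _).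
  by rewrite /GRing.scale /=; move: (sin t * cos t) => w; field.
have cg (r : R) : u < r < v -> continuous (g r).
  move=> /cpt cp x; rewrite /g.
  apply: (@continuousD _ _ _ (pt r) (fun t => k * (sin t * cos t) ^+ 2)); first exact: cp.
  apply: differentiable_continuous; apply/derivable1_diffP.
  exact: (@ex_derive _ _ _ _ _ (k *: (sin * cos) ^+ 2)).
have FTC (r : R) : u < r < v -> \int[mu]_(t in I) g r t = k / 8 * T.
  move=> h; rewrite /Rintegral.
  have -> : (\int[mu]_(t in I) (g r t)%:E)%E = ((G r T)%:E - (G r 0)%:E)%E.
    apply: (@continuous_FTC2 R (g r) (G r) 0 T T0).
    - by apply: continuous_subspaceT => x; exact: cg.
    - have cG x : {for x, continuous (G r)}.
        apply: differentiable_continuous; apply/derivable1_diffP.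
        by have [] := dG r x h.
      split=> [x _||]; first by have [] := dG r x h.
        exact: cvg_at_right_filter (cG 0).
      exact: cvg_at_left_filter (cG T).
    - by move=> x _; rewrite derive1E; have [_ ->] := dG r x h.
  by rewrite /= /G -per // sin0 sin2pi !mul0r !subr0 mulr0 addr0 addrC addKr.
have dm_le (r : R) : u < r < v ->
    \int[mu]_(t in I) qr r t <= - (k / 8 * T / r) + C * T.
  move=> h; have -> : - (k / 8 * T / r) + C * T =
      \int[mu]_(t in I) (- r^-1 * g r t + C).
    rewrite RintegralD //; last by apply: intI => x; exact: cvg_cst.
      rewrite RintegralZl //; last by apply: intI; exact: cg.
      by rewrite FTC // Rintegral_cst // muI mulNr [X in - X]mulrC.
    apply: intI => x; apply: (@continuousM _ _ (cst (- r^-1)) (g r)).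
      exact: cvg_cst.
    exact: cg.
  apply: le_Rintegral => //; first by apply: intI; exact: cqr.
    apply: intI => x; apply: (@continuousD _ _ _ (fun t => - r^-1 * g r t) (cst C)).
      apply: (@continuousM _ _ (cst (- r^-1)) (g r)); first exact: cvg_cst.
      exact: cg.
    exact: cvg_cst.
  move=> t _; apply: le_trans (ineq r t h) _; rewrite /g.
  by rewrite lerD2r mulrDr !mulNr [X in - X]mulrC lerD2l lerN2 mulrC.
have sub (x : R) : x \in `[a, b] -> u < x < v.
  by rewrite in_itv /= => /andP[ax xb]; rewrite (lt_le_trans ua ax) (le_lt_trans xb bv).
pose f x := m x + (k / 8 * T) * ln x - C * T * x.
have df (x : R) : u < x < v -> is_derive x 1 f
    (\int[mu]_(t in I) qr x t + k / 8 * T * x^-1 - C * T).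
  move=> h; have h1 := dm x h; have h2 := is_derive1_ln (r_gt0 x h).
  have H := is_deriveB (is_deriveD h1 (is_deriveZ (k / 8 * T) h2))
    (is_deriveZ (C * T) (is_derive_id x 1)).
  by apply: is_derive_eq H _; rewrite /GRing.scale /= mulr1.
have fab : f b <= f a.
  apply: (@ler0_derive1_le_cc _ f a b).
  - by move=> x /subset_itv_oo_cc/sub/df[].
  - move=> x /subset_itv_oo_cc/sub hx; rewrite derive1E; have [_ ->] := df x hx.
    by rewrite subr_le0 -lerBrDr addrC; exact: dm_le.
  - by apply: derivable_within_continuous => x /sub/df[].
  - by rewrite in_itv /= lexx ab.
  - by rewrite in_itv /= lexx ab.
  - exact: ab.
have aI : u < a < v by apply: sub; rewrite in_itv /= lexx ab.
have bI : u < b < v by apply: sub; rewrite in_itv /= lexx ab.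
rewrite -(ler_pM2l T0).
have := bm a aI; have := bm b bI; rewrite !ler_norml => /andP[mb _] /andP[_ ma].
move: fab ma mb; rewrite /f; clearbody T.
by move: (m a) (m b) (ln a) (ln b) => ma mb la lb *; lra.
Qed.

(** * Auxiliary results *)

Section line_derivatives.
Context {R : realType} {V : normedModType R}.

Lemma is_derive_line0 {W : normedModType R} (f : V -> W) (p v : V) (l : W) :
  is_derive (0 : R) 1 (fun u : R => f (p + u *: v)) l -> is_derive p v f l.
Proof.
move=> [df <-]; have E : (fun h : R => h^-1 *:
    ((f \o shift p) (h *: v) - f p)) =
    (fun h : R => h^-1 *: (((fun u : R => f (p + u *: v)) \o shift 0) (h *: 1)
      - (fun u : R => f (p + u *: v)) 0)).
  by apply/funext => h /=; rewrite scale0r !addr0 scaler1 (addrC p).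
by apply: DeriveDef; rewrite /derivable /derive E.
Qed.

Lemma is_derive_comp_scalar (f : R -> R) (g : V -> R) (p v : V) (a b : R) :
  is_derive (g p) 1 f a -> is_derive p v g b -> is_derive p v (f \o g) (a * b).
Proof.
move=> df dg; apply: is_derive_line0.
apply: (@is_derive1_comp R f (fun u : R => g (p + u *: v))).
  by rewrite scale0r addr0.
by apply: is_derive_line; rewrite scale0r addr0.
Qed.

End line_derivatives.

Lemma is_derive_coord {R : realType} {n : nat} (j : 'I_n) (p v : 'rV[R]_n) :
  is_derive p v (fun q : 'rV[R]_n => q 0 j) (v 0 j).
Proof.
apply: is_derive_line0; apply: (is_derive_eq (f' := 0 + (1 * v 0 j))); last first.
  by rewrite add0r mul1r.
have -> : (fun u : R => (p + u *: v) 0 j) = cst (p 0 j) + (fun u => id u * (cst (v 0 j)) u).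
  by apply/funext => u; rewrite !mxE.
apply: is_deriveD; apply: is_derive_eq.
by rewrite scaler0 add0r /GRing.scale /= mulr1 mul1r.
Qed.

Lemma powR_small {R : realType} (e : R) : 0 < e ->
  forall eps, 0 < eps -> exists2 d : R, 0 < d &
    forall x, 0 <= x -> x <= d -> x `^ e <= eps.
Proof.
move=> e0 eps eps0; exists (eps `^ e^-1); first exact: powR_gt0.
move=> x x0 xd; have := ge0_ler_powR (ltW e0) x0 (powR_ge0 _ _) xd.
by rewrite -powRrM mulVf ?gt_eqF // powRr1 // ltW.
Qed.

Lemma ler_powR_neg {R : realType} (e x y : R) : e <= 0 -> 0 < x -> x <= y ->
  y `^ e <= x `^ e.
Proof.
move=> e0 x0 xy; rewrite -[e]opprK !(powRN _ (- e)).
rewrite lef_pV2 ?posrE ?powR_gt0 // ?(lt_le_trans x0) //.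
by rewrite ge0_ler_powR ?nnegrE ?oppr_ge0 // ltW // (lt_le_trans x0).
Qed.

Lemma ord3_ind (P : 'I_3 -> Prop) :
  P (inord 0) -> P (inord 1) -> P (inord 2) -> forall j, P j.
Proof.
by move=> P0 P1 P2 j; have := inord_val j; case: j => -[|[|[|//]]] lt3 /= <-.
Qed.

Lemma inord3_eq (i j : nat) : (i < 3)%N -> (j < 3)%N ->
  ((inord i : 'I_3) == inord j) = (i == j).
Proof. by move=> i3 j3; rewrite -val_eqE /= !inordK. Qed.

Lemma sum3 {R : nmodType} (F : 'I_3 -> R) :
  \sum_(i < 3) F i = F (inord 0) + F (inord 1) + F (inord 2).
Proof.
rewrite !big_ord_recl big_ord0 addr0 addrA.
by congr (F _ + F _ + F _); apply/val_inj; rewrite /= inordK.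
Qed.

(** * A class of functions singular along a plane *)

Section plane_class.
Context {R : realType}.
Let ix : 'I_3 := inord 0.
Let iy : 'I_3 := inord 1.
Let it : 'I_3 := inord 2.
Implicit Types (p q : 'rV[R]_3) (a c g : R) (m n k : nat).

(** The squared Euclidean distance to the origin; the coordinates x, y, s are
    those of index 0, 1, 2. *)
Definition sqdist (p : 'rV[R]_3) : R := p 0 ix ^+ 2 + p 0 iy ^+ 2 + p 0 it ^+ 2.

(** [s ^ g x ^ m y ^ n / (x ^ 2 + y ^ 2 + s ^ 2) ^ k] on the half space [0 < s],
    extended by zero. *)
Definition half_monomial g m n k (p : 'rV[R]_3) : R :=
  if 0 < p 0 it
  then p 0 it `^ g * p 0 ix ^+ m * p 0 iy ^+ n * (sqdist p)^-1 ^+ k else 0.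

(** Linear combinations of half space monomials which are homogeneous of
    degree at least [a] and, as [m + n <= 2 k], are O(s ^ a) for bounded [s]. *)
Inductive plane_class : R -> ('rV[R]_3 -> R) -> Prop :=
| plane_class0 a : plane_class a (fun=> 0)
| plane_class_monomial a g m n k : (m + n <= k.*2)%N ->
    a <= g + (m + n)%:R - k.*2%:R -> plane_class a (half_monomial g m n k)
| plane_class_lin a c f1 f2 : plane_class a f1 -> plane_class a f2 ->
    plane_class a (fun p => c * f1 p + f2 p).

Lemma sqdist_gt0 p : 0 < p 0 it -> 0 < sqdist p.
Proof. by move=> h; rewrite ltr_wpDl ?exprn_gt0 // addr_ge0 ?sqr_ge0. Qed.

Lemma half_monomial_le g m n k p : (m + n <= k.*2)%N -> 0 < p 0 it ->
  `|half_monomial g m n k p| <= p 0 it `^ (g + (m + n)%:R - k.*2%:R).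
Proof.
move=> mnk s0; rewrite /half_monomial s0.
set s := p 0 it in s0 *; set x := p 0 ix; set y := p 0 iy.
have d0 := sqdist_gt0 s0; pose r := Num.sqrt (sqdist p).
have r0 : 0 < r by rewrite sqrtr_gt0.
have r2 : sqdist p = r ^+ 2 by rewrite sqr_sqrtr // ltW.
have le_r z : z ^+ 2 <= sqdist p -> `|z| <= r.
  by move=> h; rewrite -sqrtr_sqr ler_wsqrtr.
have xr : `|x| <= r by apply: le_r; rewrite /sqdist -addrA lerDl addr_ge0 ?sqr_ge0.
have yr : `|y| <= r.
  by apply: le_r; rewrite /sqdist addrAC lerDr addr_ge0 ?sqr_ge0.
have sr : s <= r.
  by rewrite -[s]gtr0_norm //; apply: le_r; rewrite /sqdist lerDr addr_ge0 ?sqr_ge0.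
have -> : g + (m + n)%:R - k.*2%:R = g - (k.*2 - (m + n))%N%:R.
  by rewrite natrB // opprB addrA.
rewrite powRB; last by rewrite (gt_eqF s0) implybT.
rewrite powR_mulrn ?(ltW s0) // -!mulrA normrM ger0_norm ?powR_ge0 //.
rewrite ler_wpM2l ?powR_ge0 // !normrM !normrX.
have -> : `|(sqdist p)^-1| = (r ^+ 2)^-1 by rewrite -r2 gtr0_norm // invr_gt0.
apply: (@le_trans _ _ (r ^+ m * (r ^+ n * (r ^+ 2)^-1 ^+ k))).
  rewrite ler_pM ?lerXn2r ?nnegrE ?(ltW r0) ?exprn_ge0 //.
    by rewrite mulr_ge0 ?exprn_ge0 ?invr_ge0 // sqr_ge0.
  by rewrite ler_wpM2r ?exprn_ge0 ?invr_ge0 ?sqr_ge0 ?lerXn2r ?nnegrE ?(ltW r0).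
have E : r ^+ k.*2 = r ^+ (m + n) * r ^+ (k.*2 - (m + n)) by rewrite -exprD subnKC.
rewrite exprVn -exprM mul2n mulrA -exprD E invfM mulrA.
rewrite divff ?expf_neq0 ?gt_eqF // mul1r lef_pV2 ?posrE ?exprn_gt0 //.
by rewrite lerXn2r // nnegrE ltW.
Qed.

Lemma near_half p : 0 < p 0 it -> nbhs p [set q : 'rV[R]_3 | 0 < q 0 it].
Proof.
move=> s0; have := @coord_continuous R 1 3 0 it p.
by move=> /cvgr_gt; apply.
Qed.

Let formula g m n k : 'rV[R]_3 -> R :=
  (fun q => q 0 it `^ g) * (fun q => q 0 ix) ^+ m * (fun q => q 0 iy) ^+ n *
  (fun q => (sqdist q)^-1) ^+ k.

Let near_formula g m n k p : 0 < p 0 it ->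
  \forall q \near p, formula g m n k q = half_monomial g m n k q.
Proof.
move=> /near_half; apply: filterS => q q0.
by rewrite /half_monomial q0 /formula !fctE.
Qed.

Let differentiable_exprn (f : 'rV[R]_3 -> R) n p :
  differentiable f p -> differentiable (f ^+ n) p.
Proof.
case: n => [|n] df; last exact: differentiableX.
by rewrite expr0; exact: (@differentiable_cst _ _ _ (1 : R)).
Qed.

Let sqdistE : sqdist = (fun q : 'rV[R]_3 => q 0 ix) ^+ 2 +
    (fun q => q 0 iy) ^+ 2 + (fun q => q 0 it) ^+ 2.
Proof. by apply/funext => q; rewrite !fctE. Qed.

Lemma half_monomial_continuous g m n k p : 0 < p 0 it ->
  {for p, continuous (half_monomial g m n k)}.
Proof.
move=> s0; have cf : {for p, continuous (formula g m n k)}.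
  have cc j : differentiable (fun q : 'rV[R]_3 => q 0 j) p by exact: differentiable_coord.
  apply: differentiable_continuous; apply: differentiableM; last first.
    apply: differentiable_exprn; apply: differentiableV.
      by rewrite sqdistE; apply: differentiableD; [apply: differentiableD|]; apply: differentiable_exprn.
    exact: lt0r_neq0 (sqdist_gt0 s0).
  apply: differentiableM; last exact: differentiable_exprn.
  apply: differentiableM; last exact: differentiable_exprn.
  apply: (@differentiable_comp _ _ _ _ (fun q : 'rV[R]_3 => q 0 it) (@powR R ^~ g)) => //.
  by apply/derivable1_diffP; have [] := is_derive1_powR g s0.
have nf := near_formula g m n k s0.
rewrite /continuous_at; apply: cvg_trans (near_eq_cvg nf) _.
by rewrite -(nbhs_singleton nf); exact: cf.
Qed.

(** The derivative of a half space monomial in the direction [v]; the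
    predecessor of a zero exponent comes with a zero coefficient. *)
Definition half_monomial_diff (v : 'rV[R]_3) g m n k (p : 'rV[R]_3) : R :=
  (g * v 0 it) * half_monomial (g - 1) m n k p +
  ((m%:R * v 0 ix) * half_monomial g m.-1 n k p +
  ((n%:R * v 0 iy) * half_monomial g m n.-1 k p +
  ((- (2 * k%:R * v 0 ix)) * half_monomial g m.+1 n k.+1 p +
  ((- (2 * k%:R * v 0 iy)) * half_monomial g m n.+1 k.+1 p +
  ((- (2 * k%:R * v 0 it)) * half_monomial (g + 1) m n k.+1 p + 0))))).

Lemma half_monomial_is_derive g m n k p v : 0 < p 0 it ->
  is_derive p v (half_monomial g m n k) (half_monomial_diff v g m n k p).
Proof.
move=> s0; have h := near_formula g m n k s0.
apply: (near_eq_is_derive h).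
have dx := is_derive_coord ix p v; have dy := is_derive_coord iy p v.
have ds := is_derive_coord it p v.
have dpow := is_derive_comp_scalar (is_derive1_powR g s0) ds.
have d0 : sqdist p != 0 by exact: lt0r_neq0 (sqdist_gt0 s0).
have dsq : is_derive p v sqdist
  (2 * (p 0 ix * v 0 ix + p 0 iy * v 0 iy + p 0 it * v 0 it)).
  have H := is_deriveD (is_deriveD (is_deriveM dx dx) (is_deriveM dy dy)) (is_deriveM ds ds).
  by apply: is_derive_eq H _; rewrite /GRing.scale /=; ring.
have dinv : is_derive p v (fun q => (sqdist q)^-1) (- (sqdist p) ^- 2 *
    (2 * (p 0 ix * v 0 ix + p 0 iy * v 0 iy + p 0 it * v 0 it))).
  have [dsq1 dsq2] := dsq; apply: DeriveDef; first exact: derivableV.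
  by rewrite (deriveV (f := sqdist)) //; congr (_ * _).
rewrite /formula; apply: is_derive_eq.
rewrite /half_monomial_diff /half_monomial s0 /GRing.scale /= !fctE.
have -> : p 0 it `^ (g + 1) = p 0 it `^ g * p 0 it.
  by rewrite powRD ?powRr1 ?(ltW s0) // (gt_eqF s0) implybT.
set D := 2 * (_ + _ + _); set w := (sqdist p)^-1.
have -> : k%:R * w ^+ k.-1 * (- sqdist p ^- 2 * D) = - (k%:R * w ^+ k.+1 * D).
  rewrite -exprVn -/w mulNr mulrN; congr (- _).
  case: (k) => [|k'] /=; first by rewrite !mul0r.
  by rewrite !exprS expr0 mulr1; ring.
rewrite /D !exprS.
move: (p 0 it `^ g) (p 0 it `^ (g - 1)) (p 0 ix ^+ m) (p 0 ix ^+ m.-1)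
  (p 0 iy ^+ n) (p 0 iy ^+ n.-1) (w ^+ k) => z1 z2 z3 z4 z5 z6 z7.
by ring.
Qed.

Lemma plane_classD a c f1 f2 : (c != 0 -> plane_class a f1) ->
  plane_class a f2 -> plane_class a (fun p => c * f1 p + f2 p).
Proof.
move=> H1 H2; have [c0|/H1 cf] := eqVneq c 0; last exact: plane_class_lin.
have -> : (fun p => c * f1 p + f2 p) = f2.
  by apply/funext => p; rewrite c0 mul0r add0r.
exact: H2.
Qed.

Lemma half_monomial_diff_class v a g m n k : (m + n <= k.*2)%N ->
  a <= g + (m + n)%:R - k.*2%:R ->
  plane_class (a - 1) (half_monomial_diff v g m n k).
Proof.
move=> mnk ha; rewrite /half_monomial_diff; apply: plane_classD => [_|].
  by apply: plane_class_monomial => //; lra.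
apply: plane_classD => [|].
  case: m mnk ha => [|m] mnk ha; rewrite ?mul0r ?eqxx // => _.
  apply: plane_class_monomial; first exact: leq_trans mnk.
  by move: ha; rewrite addSn -[(m + n).+1%:R]natr1 /=; lra.
apply: plane_classD => [|].
  case: n mnk ha => [|n] mnk ha; rewrite ?mul0r ?eqxx // => _.
  apply: plane_class_monomial; first by apply: leq_trans mnk; rewrite addnS.
  by move: ha; rewrite addnS -[(m + n).+1%:R]natr1 /=; lra.
have kE : k.+1.*2%:R = k.*2%:R + 2 :> R by rewrite doubleS -addn2 natrD.
apply: plane_classD => [_|].
  apply: plane_class_monomial; first by rewrite doubleS addSn ltnS leqW.
  by rewrite kE addSn -[(m + n).+1%:R]natr1; lra.
apply: plane_classD => [_|].
  apply: plane_class_monomial; first by rewrite doubleS addnS ltnS leqW.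
  by rewrite kE addnS -[(m + n).+1%:R]natr1; lra.
apply: plane_classD => [_|]; last exact: plane_class0.
apply: plane_class_monomial; first by rewrite doubleS !leqW.
by rewrite kE; lra.
Qed.

Lemma plane_class_mono a b f : a <= b -> plane_class b f -> plane_class a f.
Proof.
move=> + cf; elim: cf a => {b f} [b|b g m n k mnk hb|b c f1 f2 _ IH1 _ IH2] a ab.
- exact: plane_class0.
- by apply: plane_class_monomial => //; exact: le_trans ab hb.
- by apply: plane_class_lin; [exact: IH1|exact: IH2].
Qed.

Lemma plane_class_diff a f : plane_class a f -> forall v,
  exists2 f', plane_class (a - 1) f' &
    forall p, 0 < p 0 it -> is_derive p v f (f' p).
Proof.
elim=> {a f} [a|a g m n k mnk ha|a c f1 f2 _ IH1 _ IH2] v.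
- by exists (fun=> 0); [exact: plane_class0 | move=> p _; exact: is_derive_cst].
- exists (half_monomial_diff v g m n k); first exact: half_monomial_diff_class mnk ha.
  by move=> p; exact: half_monomial_is_derive.
- have [g1 cg1 d1] := IH1 v; have [g2 cg2 d2] := IH2 v.
  exists (fun p => c * g1 p + g2 p); first exact: plane_class_lin.
  move=> p s0; have h1 := d1 p s0; have h2 := d2 p s0.
  by apply: (@is_deriveD _ _ _ (c *: f1) f2).
Qed.

Lemma plane_class_continuous a f : plane_class a f -> forall p, 0 < p 0 it ->
  {for p, continuous f}.
Proof.
elim=> {a f} [a|a g m n k mnk ha|a c f1 f2 _ IH1 _ IH2] p s0.
- exact: cst_continuous.
- exact: half_monomial_continuous.
- apply: (@continuousD _ _ _ (fun p => c * f1 p) f2); last exact: IH2.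
  by apply: (@continuousM _ _ (cst c) f1); [exact: cst_continuous | exact: IH1].
Qed.

Lemma plane_class_eq0 a f : plane_class a f -> forall p, p 0 it <= 0 -> f p = 0.
Proof.
elim=> {a f} [//|a g m n k mnk _|a c f1 f2 _ IH1 _ IH2] p s0.
  by rewrite /half_monomial ltNge s0.
by rewrite IH1 // IH2 // mulr0 addr0.
Qed.

Lemma plane_class_le a f M : plane_class a f -> exists2 C, 0 <= C &
  forall p, 0 < p 0 it -> p 0 it <= M -> `|f p| <= C * p 0 it `^ a.
Proof.
elim=> {a f} [a|a g m n k mnk ha|a c f1 f2 _ [C1 C10 H1] _ [C2 C20 H2]].
- by exists 0 => // p _ _; rewrite normr0 mul0r.
- set b := g + _ - _ in ha; exists (M `^ (b - a)); first exact: powR_ge0.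
  move=> p s0 sM; apply: le_trans (half_monomial_le _ mnk s0) _.
  have -> : p 0 it `^ (g + (m + n)%:R - k.*2%:R) = p 0 it `^ (b - a) * p 0 it `^ a.
    by rewrite -powRD ?subrK // (gt_eqF s0) implybT.
  by rewrite ler_wpM2r ?powR_ge0 // ge0_ler_powR ?nnegrE ?subr_ge0 ?(ltW s0) // (le_trans (ltW s0)).
- exists (`|c| * C1 + C2); first by rewrite addr_ge0 // mulr_ge0.
  move=> p s0 sM; rewrite mulrDl (le_trans (ler_normD _ _)) // lerD ?H2 //.
  by rewrite normrM -mulrA ler_wpM2l // H1.
Qed.

(** For a positive exponent the bound extends across the plane. *)
Lemma plane_class_le_sup a f M : plane_class a f -> 0 < a ->
  exists2 C, 0 <= C & forall p B, 0 <= B -> p 0 it <= B -> p 0 it <= M ->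
    `|f p| <= C * B `^ a.
Proof.
move=> cf a0; have [C C0 H] := plane_class_le M cf; exists C => // p B B0 pB pM.
have [s0|s0] := leP (p 0 it) 0.
  by rewrite (plane_class_eq0 cf s0) normr0 mulr_ge0 // powR_ge0.
apply: le_trans (H p s0 pM) _; rewrite ler_wpM2l //.
by apply: ge0_ler_powR; rewrite ?nnegrE // ltW.
Qed.

Lemma plane_class_differentiable a f : plane_class a f ->
  forall p, 0 < p 0 it -> differentiable f p.
Proof.
move=> cf p s0; apply: differentiable_partials => j;
  have [g cg dg] := plane_class_diff cf (std_basis j).
  by have := near_half s0; apply: filterS => q /dg[].
have E : {near p, g =1 'D_(std_basis j) f}.
  by have := near_half s0; apply: filterS => q /dg[_ ->].
rewrite /continuous_at; apply: cvg_trans (near_eq_cvg E) _.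
have [_ ->] := dg p s0; exact: (plane_class_continuous cg s0).
Qed.

End plane_class.

(** * Regularity of the class *)

Section plane_class_regularity.
Context {R : realType}.
Let it : 'I_3 := inord 2.
Implicit Types (p q : 'rV[R]_3) (a c g : R).

Lemma plane_class_MVT a (f : 'rV[R]_3 -> R) (g : 'I_3 -> 'rV[R]_3 -> R)
    (p q : 'rV[R]_3) (s M : R) :
  plane_class a f ->
  (forall j (z : 'rV[R]_3), 0 < z 0 it -> is_derive z (std_basis j) f (g j z)) ->
  0 < s -> s <= p 0 it <= M -> s <= q 0 it <= M ->
  exists u, [/\ 0 <= u <= 1, s <= (q + u *: (p - q)) 0 it <= M &
    f p - f q = \sum_j (p - q) 0 j * g j (q + u *: (p - q))].
Proof.
move=> cf dg s0 /andP[sp pM] /andP[sq qM].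
have seg u : 0 <= u <= 1 -> s <= (q + u *: (p - q)) 0 it <= M.
  by move=> /andP[u0 u1]; rewrite !mxE; apply/andP; split; nra.
pose df z := \sum_j (p - q) 0 j * g j z.
have [|u] := @MVT_dir _ _ f df q (p - q) 1.
  move=> u; rewrite min_l // max_r // => /seg/andP[hu _].
  have z0 := lt_le_trans s0 hu.
  have D := plane_class_differentiable cf z0.
  apply: DeriveDef; first exact: diff_derivable.
  rewrite (derive_partials _ D); apply: eq_bigr => j _.
  by have [_ ->] := dg j _ z0.
rewrite min_l // max_r // scale1r mul1r (addrC q) subrK => hu E.
by exists u; split => //; exact: seg.
Qed.

Lemma sum_norm_le (v : 'rV[R]_3) (F G : 'I_3 -> R) :
  (forall j, `|F j| <= G j) ->
  `|\sum_j v 0 j * F j| <= `|v| * \sum_j G j.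
Proof.
move=> FG; apply: le_trans (ler_norm_sum _ _ _) _; rewrite mulr_sumr.
by apply: ler_sum => j _; rewrite normrM ler_pM // coord_le_norm.
Qed.

Lemma plane_class_gradient a (f : 'rV[R]_3 -> R) : plane_class a f ->
  exists g : 'I_3 -> 'rV[R]_3 -> R, forall j, plane_class (a - 1) (g j) /\
    forall p, 0 < p 0 it -> is_derive p (std_basis j) f (g j p).
Proof.
move=> cf; have /choice[g Hg] : forall j : 'I_3, exists g : 'rV[R]_3 -> R,
    plane_class (a - 1) g /\
    forall p, 0 < p 0 it -> is_derive p (std_basis j) f (g p).
  by move=> j; have [g cg dg] := plane_class_diff cf (std_basis j); exists g.
by exists g.
Qed.

Lemma plane_class_lipschitz a (f : 'rV[R]_3 -> R) M : plane_class a f -> a <= 1 ->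
  exists2 C, 0 <= C & forall p q s, 0 < s -> s <= p 0 it <= M ->
    s <= q 0 it <= M -> `|f p - f q| <= C * s `^ (a - 1) * `|p - q|.
Proof.
move=> cf a1; have [g Hg] := plane_class_gradient cf.
have /choice[C HC] : forall j, exists C, 0 <= C /\ forall p, 0 < p 0 it ->
    p 0 it <= M -> `|g j p| <= C * p 0 it `^ (a - 1).
  by move=> j; have [C C0 H] := plane_class_le M (Hg j).1; exists C.
exists (\sum_j C j); first by apply: sumr_ge0 => j _; exact: (HC j).1.
move=> p q s s0 sp sq.
have [u [_ /andP[hu huM] ->]] := plane_class_MVT cf (fun j => (Hg j).2) s0 sp sq.
rewrite mulrC mulr_suml; apply: sum_norm_le => j.
apply: le_trans ((HC j).2 _ (lt_le_trans s0 hu) huM) _.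
by rewrite ler_wpM2l ?(HC j).1 // ler_powR_neg // subr_le0.
Qed.

Lemma holder_plane_class a (f : 'rV[R]_3 -> R) M : plane_class a f -> 0 < a < 1 ->
  exists C, forall x y : 'rV[R]_3, x 0 it <= M -> y 0 it <= M -> x != y ->
    `|x - y| `^ (- a) * `|f x - f y| <= C.
Proof.
move=> cf /andP[a0 a1].
have [C C0 HC] := plane_class_le_sup M cf a0.
have [L L0 HL] := plane_class_lipschitz M cf (ltW a1).
exists (Num.max L (2 * C * 3 `^ a)) => x y xM yM xy.
pose D := `|x - y|; have D0 : 0 < D by rewrite normr_gt0 subr_eq0.
have cD : `|x 0 it - y 0 it| <= D.
  by have := coord_le_norm (x - y) it; rewrite !mxE.
rewrite powRN mulrC ler_pdivrMr ?powR_gt0 //.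
(* far from the plane relatively to [D] the gradient bound applies, otherwise
   both values are O(D ^ a) *)
have [xD|xD] := leP (x 0 it) (2 * D).
  have D3 : 0 <= 3 * D by rewrite mulr_ge0 // ltW.
  apply: (@le_trans _ _ (2 * C * 3 `^ a * D `^ a)); last first.
    by rewrite ler_wpM2r ?powR_ge0 // le_max lexx orbT.
  rewrite -!mulrA -powRM ?(ltW D0) //.
  apply: le_trans (ler_normB _ _) _; rewrite mulr_natl mulr2n.
  move: cD; rewrite ler_norml => /andP[cD1 cD2].
  by rewrite lerD // HC //; move: cD1 cD2 xD D0; clearbody D; lra.
apply: (@le_trans _ _ (L * D `^ a)); last first.
  by rewrite ler_wpM2r ?powR_ge0 // le_max lexx.
move: cD; rewrite ler_norml => /andP[cD1 cD2].
have -> : D `^ a = D `^ (a - 1) * D by rewrite mulrC mulr_powRB1 // ltW.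
rewrite mulrA; apply: HL => //.
  by apply/andP; split => //; move: xD D0; clearbody D; lra.
by apply/andP; split => //; move: cD1 cD2 xD D0; clearbody D; lra.
Qed.

Lemma zygmund_plane_class (f : 'rV[R]_3 -> R) M : plane_class 1 f ->
  exists C, forall x y : 'rV[R]_3, x 0 it <= M -> y 0 it <= M -> x != y ->
    `|x - y|^-1 * `|(f x + f y) / 2 - f (2^-1 *: (x + y))| <= C.
Proof.
move=> cf; have [C C0 HC] := plane_class_le_sup M cf ltr01.
have [g Hg] := plane_class_gradient cf.
have /choice[L HL] : forall j, exists L, 0 <= L /\ forall p q s, 0 < s ->
    s <= p 0 it <= M -> s <= q 0 it <= M ->
    `|g j p - g j q| <= L * s^-1 * `|p - q|.
  have h01 : 1 - 1 <= 1 :> R by rewrite subrr.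
  move=> j; have [L L0 H] := plane_class_lipschitz M (Hg j).1 h01.
  exists L; split => [//|p q s s0 sp sq].
  have -> : s^-1 = s `^ (1 - 1 - 1) by rewrite subrr sub0r powR_inv1 // ltW.
  by apply: H.
exists (Num.max (4 * C) (\sum_j L j)) => x y xM yM xy.
pose D := `|x - y|; have D0 : 0 < D by rewrite normr_gt0 subr_eq0.
set c := 2^-1 *: (x + y).
have cE : c 0 it = (x 0 it + y 0 it) / 2 by rewrite !mxE mulrC.
have cM : c 0 it <= M by rewrite cE; lra.
have cD : `|x 0 it - y 0 it| <= D.
  by have := coord_le_norm (x - y) it; rewrite !mxE.
move: cD; rewrite ler_norml => /andP[cD1 cD2].
rewrite mulrC ler_pdivrMr //.
(* same alternative, with the gradient bound applied to the first derivatives *)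
have [xD|xD] := leP (c 0 it) D.
  apply: (@le_trans _ _ (4 * C * D)); last first.
    by rewrite ler_wpM2r ?(ltW D0) // le_max lexx.
  have D2 : 0 <= 2 * D by rewrite mulr_ge0 // ltW.
  have B (z : 'rV[R]_3) : z 0 it <= M -> z 0 it <= 2 * D -> `|f z| <= C * (2 * D).
    by move=> zM h; have := HC z _ D2 h zM; rewrite powRr1.
  have {B} [Bx By Bc] : [/\ `|f x| <= C * (2 * D), `|f y| <= C * (2 * D) &
      `|f c| <= C * (2 * D)].
    by split; apply: B => //; rewrite cE in xD *; move: cD1 cD2 xD D0; clearbody D; lra.
  move: Bx By Bc; rewrite !ler_norml; move: (f x) (f y) (f c) => fx fy fc.
  by clearbody D => /andP[? ?] /andP[? ?] /andP[? ?]; apply/andP; split; lra.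
apply: (@le_trans _ _ ((\sum_j L j) * D)); last first.
  by rewrite ler_wpM2r ?(ltW D0) // le_max lexx orbT.
have Dh : 0 < D / 2 by rewrite divr_gt0.
have [hx hy hc] : [/\ D / 2 <= x 0 it <= M, D / 2 <= y 0 it <= M & D / 2 <= c 0 it <= M].
  rewrite xM yM cM !andbT.
  by split; rewrite ?cE; rewrite cE in xD; move: cD1 cD2 xD D0; clearbody D; lra.
have [u1 [h1 z1 E1]] := plane_class_MVT cf (fun j => (Hg j).2) Dh hx hc.
have [u2 [h2 z2 E2]] := plane_class_MVT cf (fun j => (Hg j).2) Dh hy hc.
have xc : x - c = 2^-1 *: (x - y).
  apply/rowP => j; rewrite !mxE; lra.
have yc : y - c = - (2^-1 *: (x - y)).
  apply/rowP => j; rewrite !mxE; lra.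
set v := 2^-1 *: (x - y) in xc yc.
have nv : `|v| = D / 2 by rewrite normrZ gtr0_norm ?invr_gt0 // mulrC.
rewrite xc in E1 z1; rewrite yc in E2 z2.
have -> : (f x + f y) / 2 - f c = ((f x - f c) + (f y - f c)) / 2.
  by move: (f x) (f y) (f c) => fx fy fc; lra.
rewrite E1 E2 -big_split /= normrM [`|2^-1|]gtr0_norm ?invr_gt0 // ler_pdivrMr //.
have -> : \sum_(j < 3) (v 0 j * g j (c + u1 *: v) + (- v) 0 j * g j (c + u2 *: - v))
    = \sum_(j < 3) v 0 j * (g j (c + u1 *: v) - g j (c + u2 *: - v)).
  by apply: eq_bigr => j _; rewrite [(- v) 0 j]mxE mulrBr mulNr.
apply: (@le_trans _ _ (`|v| * \sum_j (L j * 2))).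
  apply: sum_norm_le => j.
  apply: le_trans ((HL j).2 _ _ _ Dh z1 z2) _.
  rewrite -mulrA ler_wpM2l ?(HL j).1 // mulrC ler_pdivrMr //.
  have -> : c + u1 *: v - (c + u2 *: - v) = (u1 + u2) *: v.
    by apply/rowP => i; rewrite !mxE; ring.
  move: h1 h2 => /andP[? ?] /andP[? ?].
  rewrite normrZ nv ger0_norm ?addr_ge0 //; move: Dh; clearbody D => Dh; nra.
have S0 : 0 <= \sum_j L j by apply: sumr_ge0 => j _; exact: (HL j).1.
rewrite nv -mulr_suml; move: (\sum_j L j) S0 D0 => S; clearbody D => S0 D0; nra.
Qed.

Lemma plane_class_is_derive0 a (f : 'rV[R]_3 -> R) p v : plane_class a f ->
  1 < a -> p 0 it <= 0 -> is_derive p v f 0.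
Proof.
move=> cf a1 s0; have a0 := lt_trans ltr01 a1.
have [C C0 HC] := plane_class_le_sup 1 cf a0.
have fp0 := plane_class_eq0 cf s0.
suff H : h^-1 *: ((f \o shift p) (h *: v) - f p) @[h --> 0^'] --> (0 : R).
  apply: DeriveDef; last exact: cvg_lim H.
  by apply/cvg_ex; exists 0.
apply/cvgr0Pnorm_le => eps eps0.
pose N := C * `|v| `^ a + 1.
have N0 : 0 < N by rewrite ltr_wpDl // mulr_ge0 // powR_ge0.
have am1 : 0 < a - 1 by rewrite subr_gt0.
have [d d0 Hd] := powR_small am1 (divr_gt0 eps0 N0).
near=> h.
have h0 : h != 0 by near: h; exact: nbhs_dnbhs_neq.
have hd : `|h| <= d by near: h; apply: dnbhs0_le.
have hp : 0 < `|h| by rewrite normr_gt0.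
rewrite /= fp0 subr0 normrZ normfV ler_pdivrMl //.
have V0 : 0 < `|v| + 1 by rewrite ltr_wpDl.
have B : (h *: v + p) 0 it <= `|h| * `|v|.
  rewrite !mxE; apply: (@le_trans _ _ (h * v 0 it)); first by rewrite gerDl.
  apply: le_trans (ler_norm _) _; rewrite normrM ler_wpM2l //.
  exact: coord_le_norm.
have B1 : (h *: v + p) 0 it <= 1.
  apply: le_trans B _; apply: (@le_trans _ _ (`|h| * (`|v| + 1))).
    by rewrite ler_wpM2l // lerDl.
  rewrite -ler_pdivlMr; last exact: V0.
  near: h; apply: dnbhs0_le; rewrite divr_gt0 //.
apply: le_trans (HC _ _ (mulr_ge0 (ltW hp) (normr_ge0 v)) B B1) _.
rewrite powRM // -(mulr_powRB1 (ltW hp) a0) -mulrA mulrCA ler_pM2l //.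
rewrite mulrCA mulrC; apply: le_trans (_ : N * `|h| `^ (a - 1) <= _).
  by rewrite ler_wpM2r ?powR_ge0 // /N lerDl.
by rewrite mulrC -ler_pdivlMr // Hd // ltW.
Unshelve. all: by end_near. Qed.

Lemma plane_class_bounded_continuous a (f : 'rV[R]_3 -> R) (O : set 'rV[R]_3) :
  plane_class a f -> 0 < a ->
  (exists M, forall p, O p -> p 0 it <= M) -> bounded_continuous_on O f.
Proof.
move=> cf a0 [M HM]; split.
  have [C C0 HC] := plane_class_le_sup M cf a0.
  exists (C * `|M| `^ a) => p /HM pM; apply: HC => //.
  exact: le_trans pM (ler_norm M).
move=> p _; have [s0|s0] := leP (p 0 it) 0; last exact: (plane_class_continuous cf s0).
suff H : f @ nbhs p --> (0 : R).
  by move: H; rewrite -(plane_class_eq0 cf s0).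
have [C C0 HC] := plane_class_le_sup 1 cf a0.
apply/cvgr0Pnorm_le => eps eps0.
have N0 : 0 < C + 1 by rewrite ltr_wpDl.
have [d d0 Hd] := powR_small a0 (divr_gt0 eps0 N0).
near=> q.
have qd : `|q - p| <= d.
  by rewrite distrC; near: q; have := @cvgr_dist_le _ _ _ (nbhs p) _ id p (@cvg_id _ _); apply.
have B : q 0 it <= `|q - p|.
  apply: (@le_trans _ _ ((q - p) 0 it)); first by rewrite !mxE lerDl oppr_ge0.
  exact: le_trans (ler_norm _) (coord_le_norm _ _).
have B1 : q 0 it <= 1.
  apply: le_trans B _.
  by rewrite distrC; near: q; have := @cvgr_dist_le _ _ _ (nbhs p) _ id p (@cvg_id _ _); apply.
apply: le_trans (HC _ _ (normr_ge0 _) B B1) _.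
apply: (@le_trans _ _ ((C + 1) * `|q - p| `^ a)).
  by rewrite ler_wpM2r ?powR_ge0 // lerDl.
by rewrite mulrC -ler_pdivlMr // Hd.
Unshelve. all: by end_near. Qed.

Lemma plane_class_holder_zygmund a (f : 'rV[R]_3 -> R) (O : set 'rV[R]_3) :
  plane_class a f -> 0 < a ->
  (exists M, forall p, O p -> p 0 it <= M) -> holder_zygmund O a f.
Proof.
move=> cf a0 bO; have [k ak] : exists k, a <= k%:R.
  by exists (Num.truncn a).+1; rewrite ltW // truncnS_gt.
elim: k a f a0 ak cf => [a f a0 /(lt_le_trans a0)|k IH a f a0 ak cf].
  by rewrite ltxx.
have bc := plane_class_bounded_continuous cf a0 bO.
have [a1|a1|a1] := ltgtP a 1.
- have a01 : 0 < a < 1 by rewrite a0.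
  have [M HM] := bO; have [C HC] := holder_plane_class M cf a01.
  by apply: holder_zygmund_lt1 => //; exists C => x y /HM xM /HM yM; exact: HC.
- have [g Hg] := plane_class_gradient cf.
  have D j : forall p, is_derive p (std_basis j) f (g j p).
    move=> p; have [s0|s0] := leP (p 0 it) 0; last exact: (Hg j).2.
    rewrite (plane_class_eq0 (Hg j).1 s0).
    exact: plane_class_is_derive0 cf a1 s0.
  have a10 : 0 < a - 1 by rewrite subr_gt0.
  have ak1 : a - 1 <= k%:R by rewrite lerBlDr natr1.
  apply: (holder_zygmund_gt1 a1).
  + by move=> j p _; have [] := D j p.
  + by apply: IH a10 ak1 _; apply: plane_class_mono cf; rewrite lerBlDr lerDl.
  + move=> j; have -> : 'D_(std_basis j) f = g j.
      by apply/funext => p; have [_ ->] := D j p.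
    exact: IH a10 ak1 (Hg j).1.
- rewrite a1 in cf *; have [M HM] := bO; have [C HC] := zygmund_plane_class M cf.
  by apply: holder_zygmund_eq1 => //; exists C => x y /HM xM /HM yM _; exact: HC.
Qed.

End plane_class_regularity.

(** * The structure spanned by d/dx + (r + i) d/dy *)

Section leaf_bundle.
Local Open Scope complex_scope.
Context {R : realType}.
Let ix : 'I_3 := inord 0.
Let iy : 'I_3 := inord 1.
Let it : 'I_3 := inord 2.

Let xy : (ix == iy) = false. Proof. exact: inord3_eq. Qed.
Let yx : (iy == ix) = false. Proof. exact: inord3_eq. Qed.
Let tx : (it == ix) = false. Proof. exact: inord3_eq. Qed.
Let ty : (it == iy) = false. Proof. exact: inord3_eq. Qed.

(** The vector d/dx + (t + i) d/dy. *)
Definition leaf_vector (t : R) : 'rV[R[i]]_3 :=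
  delta_mx 0 ix + (t +i* 1) *: delta_mx 0 iy.

(** The line bundle spanned by d/dx + (r + i) d/dy. *)
Definition leaf_bundle (r : 'rV[R]_3 -> R) : cdistribution R :=
  fun p => <[leaf_vector (r p)]>%VS.

Lemma leaf_vectorE t : [/\ leaf_vector t 0 ix = 1, leaf_vector t 0 iy = t +i* 1 &
  leaf_vector t 0 it = 0].
Proof.
by rewrite /leaf_vector !mxE !eqxx /= xy yx tx ty !(mulr0, mulr1, addr0, add0r).
Qed.

Let scE (k : R[i]) (w : 'rV[R[i]]_3) j : (k *: w) 0 j = k * w 0 j.
Proof. by rewrite mxE. Qed.

Lemma mem_leaf t v : (v \in <[leaf_vector t]>%VS) <->
  v 0 iy = (t +i* 1) * v 0 ix /\ v 0 it = 0.
Proof.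
have [Ex Ey Et] := leaf_vectorE t; split.
  by case/vlineP => k ->; rewrite !scE Ex Ey Et mulr1 mulr0 mulrC.
move=> [vy vt]; apply/vlineP; exists (v 0 ix); apply/rowP; apply: ord3_ind.
- by rewrite scE Ex mulr1.
- by rewrite scE Ey vy mulrC.
- by rewrite scE Et vt mulr0.
Qed.

Lemma leaf_vector_neq0 t : leaf_vector t != 0.
Proof.
apply/eqP => E; have [Ex _ _] := leaf_vectorE t; move: Ex.
by rewrite E mxE => /eqP; rewrite eq_sym oner_eq0.
Qed.

Lemma leaf_bundle_rank r : has_rank 1 (leaf_bundle r).
Proof.
by move=> p; rewrite dim_vline leaf_vector_neq0.
Qed.

(** The sum with the conjugate bundle is spanned by d/dx and d/dy, whatever
    [r] is. *)
Lemma mem_leaf_sum r p (v : 'rV[R[i]]_3) :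
  (v \in add_bundle (leaf_bundle r) (conj_bundle (leaf_bundle r)) p) <->
  v 0 it = 0.
Proof.
rewrite /add_bundle /conj_bundle; split.
  move=> /memv_addP[u /mem_leaf[_ ut] [w]]; rewrite mem_conj_vspace.
  move=> /mem_leaf[_ wt ->]; rewrite mxE ut add0r.
  by move: wt; rewrite mxE => wt; rewrite -[w 0 it]conjcK wt conjc0.
move=> vt; apply/memv_addP; set t := r p.
have i2 : (0 +i* 2 : R[i]) != 0.
  by apply/eqP => -[] /eqP; rewrite pnatr_eq0.
pose a := (v 0 iy - (t -i* 1) * v 0 ix) / (0 +i* 2).
pose b := ((t +i* 1) * v 0 ix - v 0 iy) / (0 +i* 2).
have tt : (t +i* 1) - (t -i* 1) = 0 +i* 2 :> R[i].
  by apply/eqP; rewrite eq_complex /= subrr eqxx opprK -mulr2n eqxx.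
have [Ex Ey Et] := leaf_vectorE t.
exists (a *: leaf_vector t); first by rewrite memvZ // memv_line.
exists (b *: conjv (leaf_vector t)).
  have cZ (k : R[i]) (w : 'rV[R[i]]_3) : conjv (k *: w) = k^* *: conjv w.
    by apply/rowP => j; rewrite !mxE rmorphM.
  by rewrite mem_conj_vspace cZ conjvK memvZ // memv_line.
have cj j : conjv (leaf_vector t) 0 j = (leaf_vector t 0 j)^* by rewrite mxE.
apply/rowP; apply: ord3_ind; rewrite [RHS]mxE !scE cj ?Ex ?Ey ?Et.
- rewrite conjc1 !mulr1 /a /b -mulrDl.
  have -> : v 0 iy - (t -i* 1) * v 0 ix + ((t +i* 1) * v 0 ix - v 0 iy) =
      ((t +i* 1) - (t -i* 1)) * v 0 ix by ring.
  by rewrite tt mulrAC divff // mul1r.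
- have -> : (t +i* 1)^* = t -i* 1 by [].
  have -> : a * (t +i* 1) + b * (t -i* 1) =
      ((t +i* 1) - (t -i* 1)) * v 0 iy / (0 +i* 2) by rewrite /a /b; ring.
  by rewrite tt mulrAC divff // mul1r.
- by rewrite conjc0 !mulr0 addr0.
Qed.

Lemma leaf_sum_basis r p :
  basis_of (add_bundle (leaf_bundle r) (conj_bundle (leaf_bundle r)) p)
    [:: delta_mx 0 ix; delta_mx 0 iy].
Proof.
rewrite basisEfree; apply/and3P; split.
- rewrite free_cons span_seq1 seq1_free; apply/andP; split.
    apply/negP => /vlineP[k] /rowP/(_ ix); rewrite !mxE !eqxx xy /= mulr0 => /eqP.
    by rewrite oner_eq0.
  apply/eqP => /rowP/(_ iy); rewrite !mxE !eqxx => /eqP.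
  by rewrite oner_eq0.
- apply/span_subvP => v; rewrite !inE => /orP[] /eqP ->; apply/mem_leaf_sum.
    by rewrite mxE tx andbF.
  by rewrite mxE ty andbF.
- apply: leq_trans (dim_span [:: delta_mx 0 ix; delta_mx 0 iy]); apply: dimvS.
  apply/subvP => v /mem_leaf_sum vt.
  have -> : v = v 0 ix *: delta_mx 0 ix + v 0 iy *: delta_mx 0 iy.
    apply/rowP; apply: ord3_ind; rewrite [RHS]mxE !scE !mxE !eqxx /= ?xy ?yx ?tx ?ty.
    + by rewrite mulr1 mulr0 addr0.
    + by rewrite mulr1 mulr0 add0r.
    + by rewrite !mulr0 addr0.
  by rewrite memvD // memvZ // memv_span // !inE eqxx ?orbT.
Qed.

Lemma leaf_sum_rank r :
  has_rank 2 (add_bundle (leaf_bundle r) (conj_bundle (leaf_bundle r))).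
Proof. by move=> p; exact: (@size_basis _ _ _ 2 [tuple _; _] (leaf_sum_basis r p)). Qed.

Lemma leaf_bundle_subbundle r a : 0 < a ->
  (forall p e, holder_zygmund (ball p e) a r) ->
  tangent_subbundle a 1 (leaf_bundle r).
Proof.
move=> a0 Hr; split; first exact: leaf_bundle_rank.
move=> p; exists 1 => //; exists (fun _ q => leaf_vector (r q)); split.
  have cst_ok (c : R) : holder_zygmund (ball p 1) a (fun=> c) by exact: holder_zygmund_cst.
  move=> _; apply: ord3_ind.
  - have E q : leaf_vector (r q) 0 (inord 0) = 1 by have [] := leaf_vectorE (r q).
    by split; under eq_fun do rewrite E; exact: cst_ok.
  - have E q : leaf_vector (r q) 0 (inord 1) = r q +i* 1 by have [] := leaf_vectorE (r q).
    by split; under eq_fun do rewrite E; [exact: Hr | exact: cst_ok].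
  - have E q : leaf_vector (r q) 0 (inord 2) = 0 by have [] := leaf_vectorE (r q).
    by split; under eq_fun do rewrite E; exact: cst_ok.
move=> q _; have -> : [seq leaf_vector (r q) | _ : 'I_1] = [:: leaf_vector (r q)].
  by rewrite /image_mem enum_ordSl enum_ord0.
exact: seq1_basis (leaf_vector_neq0 _).
Qed.

Lemma leaf_sum_subbundle r a : 0 < a ->
  tangent_subbundle a 2 (add_bundle (leaf_bundle r) (conj_bundle (leaf_bundle r))).
Proof.
move=> a0; split; first exact: leaf_sum_rank.
move=> p; exists 1 => //.
exists (fun (i : 'I_2) _ => delta_mx 0 (if val i == 0%N then ix else iy)).
by split; [move=> i j; split; exact: holder_zygmund_cst|move=> q _;
  rewrite /image_mem enum_ordSl enum_ordSl enum_ord0; exact: leaf_sum_basis].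
Qed.

(* continuity at a point of the real and imaginary parts *)
Let ccont (f : 'rV[R]_3 -> R[i]) p :=
  {for p, continuous (fun q => complex.Re (f q))} /\
  {for p, continuous (fun q => complex.Im (f q))}.

Let ccontM f g p : ccont f p -> ccont g p -> ccont (fun q => f q * g q) p.
Proof.
move=> [f1 f2] [g1 g2]; split.
  have -> : (fun q => complex.Re (f q * g q)) =
     (fun q => complex.Re (f q)) * (fun q => complex.Re (g q)) -
     (fun q => complex.Im (f q)) * (fun q => complex.Im (g q)).
    by apply/funext => q; rewrite !fctE; case: (f q) (g q) => [? ?] [? ?].
  by apply: continuousB; apply: continuousM.
have -> : (fun q => complex.Im (f q * g q)) =
   (fun q => complex.Re (f q)) * (fun q => complex.Im (g q)) +
   (fun q => complex.Im (f q)) * (fun q => complex.Re (g q)).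
  by apply/funext => q; rewrite !fctE; case: (f q) (g q) => [? ?] [? ?].
by apply: continuousD; apply: continuousM.
Qed.

Let ccontB f g p : ccont f p -> ccont g p -> ccont (fun q => f q - g q) p.
Proof.
move=> [f1 f2] [g1 g2]; split.
  have -> : (fun q => complex.Re (f q - g q)) =
     (fun q => complex.Re (f q)) - (fun q => complex.Re (g q)).
    by apply/funext => q; rewrite !fctE; case: (f q) (g q) => [? ?] [? ?].
  exact: continuousB.
have -> : (fun q => complex.Im (f q - g q)) =
   (fun q => complex.Im (f q)) - (fun q => complex.Im (g q)).
  by apply/funext => q; rewrite !fctE; case: (f q) (g q) => [? ?] [? ?].
exact: continuousB.
Qed.

Let ccontD f g p : ccont f p -> ccont g p -> ccont (fun q => f q + g q) p.
Proof.
move=> [f1 f2] [g1 g2]; split.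
  have -> : (fun q => complex.Re (f q + g q)) =
     (fun q => complex.Re (f q)) + (fun q => complex.Re (g q)).
    by apply/funext => q; rewrite !fctE; case: (f q) (g q) => [? ?] [? ?].
  exact: continuousD.
have -> : (fun q => complex.Im (f q + g q)) =
   (fun q => complex.Im (f q)) + (fun q => complex.Im (g q)).
  by apply/funext => q; rewrite !fctE; case: (f q) (g q) => [? ?] [? ?].
exact: continuousD.
Qed.

(** The bracket of C^1 fields is continuous. *)
Lemma lie_bracket_C0 (O : set 'rV[R]_3) (X Y : cfield R) :
  componentwise (C1_on O) X -> componentwise (C1_on O) Y ->
  componentwise (C0_on O) (lie_bracket X Y).
Proof.
move=> CX CY j.
have cc (Z : cfield R) : componentwise (C1_on O) Z -> forall i p, O p ->
    ccont (fun q => Z q 0 i) p /\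
    forall k, ccont (cpartial k (fun q => Z q 0 i)) p.
  move=> CZ i p Op; have [/(_ p Op)[d1 c1] /(_ p Op)[d2 c2]] := CZ i.
  split; first by split; exact: differentiable_continuous.
  by move=> k; split; [exact: c1|exact: c2].
have H p : O p -> ccont (fun q => lie_bracket X Y q 0 j) p.
  move=> Op.
  have -> : (fun q => lie_bracket X Y q 0 j) = (fun q =>
      (X q 0 ix * cpartial ix (fun q => Y q 0 j) q -
       Y q 0 ix * cpartial ix (fun q => X q 0 j) q) +
      (X q 0 iy * cpartial iy (fun q => Y q 0 j) q -
       Y q 0 iy * cpartial iy (fun q => X q 0 j) q) +
      (X q 0 it * cpartial it (fun q => Y q 0 j) q -
       Y q 0 it * cpartial it (fun q => X q 0 j) q)).
    by apply/funext => q; rewrite mxE sum3.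
  have T i : ccont (fun q => X q 0 i * cpartial i (fun q => Y q 0 j) q -
       Y q 0 i * cpartial i (fun q => X q 0 j) q) p.
    have [Xi _] := cc X CX i p Op; have [Yi _] := cc Y CY i p Op.
    have [_ /(_ i) Xj] := cc X CX j p Op; have [_ /(_ i) Yj] := cc Y CY j p Op.
    exact: ccontB (ccontM Xi Yj) (ccontM Yi Xj).
  exact: ccontD (ccontD (T ix) (T iy)) (T it).
by split=> p /H[].
Qed.

Lemma cpartial_near i (f g : 'rV[R]_3 -> R[i]) p :
  {near p, f =1 g} -> cpartial i f p = cpartial i g p.
Proof.
move=> fg; rewrite /cpartial; congr (_ +i* _); apply: near_eq_derive;
  by apply: filterS fg => q ->.
Qed.

Lemma cpartial0 i (p : 'rV[R]_3) : cpartial i (fun=> 0 : R[i]) p = 0.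
Proof. by rewrite /cpartial !derive_cst. Qed.

Lemma involutive_leaf_sum r : involutive_bundle
  (add_bundle (leaf_bundle r) (conj_bundle (leaf_bundle r))).
Proof.
move=> O X Y oO CX SX CY SY; split; first exact: lie_bracket_C0.
move=> p Op; apply/mem_leaf_sum; rewrite mxE.
have Z (W : cfield R) i : section_on O (add_bundle (leaf_bundle r)
    (conj_bundle (leaf_bundle r))) W -> cpartial i (fun q => W q 0 it) p = 0.
  move=> SW; rewrite -(cpartial0 i p); apply: cpartial_near.
  by near=> q; apply/(mem_leaf_sum r q)/SW; near: q; exact: open_nbhs_nbhs.
by rewrite big1 // => i _; rewrite !Z // !mulr0 subrr.
Unshelve. all: by end_near. Qed.

(* the components along d/dx and d/dy of the bracket of [X] and [Y], once the
   derivatives of [Xy = c Xx] and [Yy = c Yx] are expanded *)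
Let bracket_algebra (c Xx Xy Xt Yx Yy Yt rx ry Yxx Yxy Yxt Yyx Yyy Yyt Xxx Xxy Xxt
    Xyx Xyy Xyt : R[i]) :
  Xy = c * Xx -> Xt = 0 -> Yy = c * Yx -> Yt = 0 ->
  Yyx = rx * Yx + c * Yxx -> Yyy = ry * Yx + c * Yxy ->
  Xyx = rx * Xx + c * Xxx -> Xyy = ry * Xx + c * Xxy ->
  Xx * Yyx - Yx * Xyx + (Xy * Yyy - Yy * Xyy) + (Xt * Yyt - Yt * Xyt) =
  c * (Xx * Yxx - Yx * Xxx + (Xy * Yxy - Yy * Xxy) + (Xt * Yxt - Yt * Xxt)).
Proof. by move=> -> -> -> -> -> -> -> ->; ring. Qed.

Lemma involutive_leaf r : (forall j p, derivable r p (std_basis j)) ->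
  involutive_bundle (leaf_bundle r).
Proof.
move=> dr O X Y oO CX SX CY SY; split; first exact: lie_bracket_C0.
move=> p Op; apply/mem_leaf.
have Z (W : cfield R) i : section_on O (leaf_bundle r) W ->
    cpartial i (fun q => W q 0 it) p = 0.
  move=> SW; rewrite -(cpartial0 i p); apply: cpartial_near.
  by near=> q; apply: (proj2 (proj1 (mem_leaf (r q) _) (SW q _))); near: q;
    exact: open_nbhs_nbhs.
have D (W : cfield R) i : componentwise (C1_on O) W ->
    section_on O (leaf_bundle r) W -> cpartial i (fun q => W q 0 iy) p =
    ('D_(std_basis i) r p)%:C * W p 0 ix +
      (r p +i* 1) * cpartial i (fun q => W q 0 ix) p.
  move=> CW SW.
  have -> : cpartial i (fun q => W q 0 iy) p =
      cpartial i (fun q => (r q +i* 1) * W q 0 ix) p.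
    apply: cpartial_near.
    by near=> q; apply: (proj1 (proj1 (mem_leaf (r q) _) (SW q _))); near: q;
      exact: open_nbhs_nbhs.
  have [/(_ p Op)[d1 _] /(_ p Op)[d2 _]] := CW ix.
  have e1 := derivableP (diff_derivable (v := std_basis i) d1).
  have e2 := derivableP (diff_derivable (v := std_basis i) d2).
  have e3 := derivableP (dr i p).
  have E1 : is_derive p (std_basis i)
      (fun q => complex.Re ((r q +i* 1) * W q 0 ix))
      (r p * 'D_(std_basis i) (fun q => complex.Re (W q 0 ix)) p +
       complex.Re (W p 0 ix) * 'D_(std_basis i) r p -
       'D_(std_basis i) (fun q => complex.Im (W q 0 ix)) p).
    have -> : (fun q => complex.Re ((r q +i* 1) * W q 0 ix)) =
        r * (fun q => complex.Re (W q 0 ix)) - (fun q => complex.Im (W q 0 ix)).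
      apply/funext => q; rewrite !fctE; case: (W q 0 ix) => [? ?] /=.
      by rewrite mul1r.
    by apply: is_deriveB; apply: is_deriveM.
  have E2 : is_derive p (std_basis i)
      (fun q => complex.Im ((r q +i* 1) * W q 0 ix))
      (r p * 'D_(std_basis i) (fun q => complex.Im (W q 0 ix)) p +
       complex.Im (W p 0 ix) * 'D_(std_basis i) r p +
       'D_(std_basis i) (fun q => complex.Re (W q 0 ix)) p).
    have -> : (fun q => complex.Im ((r q +i* 1) * W q 0 ix)) =
        r * (fun q => complex.Im (W q 0 ix)) + (fun q => complex.Re (W q 0 ix)).
      apply/funext => q; rewrite !fctE; case: (W q 0 ix) => [? ?] /=.
      by rewrite mul1r.
    by apply: is_deriveD; apply: is_deriveM.
  have [_ F1] := E1; have [_ F2] := E2; rewrite {1}/cpartial F1 F2 /cpartial.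
  move: ('D_(std_basis i) (fun q => complex.Re (W q 0 ix)) p)
    ('D_(std_basis i) (fun q => complex.Im (W q 0 ix)) p) ('D_(std_basis i) r p).
  case: (W p 0 ix) => a b c d e; apply/eqP; rewrite eq_complex /=.
  by apply/andP; split; apply/eqP; ring.
split; rewrite !mxE; last by rewrite big1 // => i _; rewrite !Z // !mulr0 subrr.
have [Xy Xt] := proj1 (mem_leaf (r p) _) (SX p Op).
have [Yy Yt] := proj1 (mem_leaf (r p) _) (SY p Op).
rewrite !sum3.
exact: bracket_algebra Xy Xt Yy Yt (D Y ix CY SY) (D Y iy CY SY) (D X ix CX SX) (D X iy CX SX).
Unshelve. all: by end_near. Qed.

Lemma leaf_bundle_frobenius r a : 0 < a ->
  (forall p e, holder_zygmund (ball p e) a r) ->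
  (forall j p, derivable r p (std_basis j)) ->
  frobenius_structure a (leaf_bundle r).
Proof.
move=> a0 Hr dr; split.
- by exists 1%N; exact: leaf_bundle_subbundle.
- by exists 2%N; exact: leaf_sum_subbundle.
- exact: involutive_leaf.
- exact: involutive_leaf_sum.
Qed.

End leaf_bundle.

(** * The equations satisfied by a chart *)

Section chart_equations.
Local Open Scope complex_scope.
Context {R : realType}.
Let ix : 'I_3 := inord 0.
Let iy : 'I_3 := inord 1.
Let it : 'I_3 := inord 2.

Lemma dz_entry (Phi : 'rV[R]_3 -> 'rV[R]_3) w k :
  ('D_(std_basis ix) Phi w) 0 k = 2 * complex.Re (dz Phi w 0 k) /\
  ('D_(std_basis iy) Phi w) 0 k = - (2 * complex.Im (dz Phi w 0 k)).
Proof.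
set u := 'D_(std_basis ix) Phi w; set v := 'D_(std_basis iy) Phi w.
have H (c d : R) (z : R[i]) : z + z = c -i* d ->
    c = 2 * complex.Re z /\ d = - (2 * complex.Im z).
  by case: z => a b [h1 h2] /=; split; lra.
apply: H; rewrite /dz mxE; set y := (X in _ * X).
have -> : 2^-1 * y + 2^-1 * y = y by field.
rewrite /y !mxE; apply/eqP; rewrite eq_complex /=.
by rewrite !(mul0r, mulr0, mul1r, mulr1, subr0, addr0, add0r, oppr0, sub0r) !eqxx.
Qed.

(** Symmetry of second derivatives of the inverse chart [Phi]: the real and
    imaginary parts of d/dz commute. *)
Lemma chart_commute (U : set 'rV[R]_3) (F Phi : 'rV[R]_3 -> 'rV[R]_3) (a : R) :
  1 < a -> C1_chart U F Phi ->
  componentwise (holder_zygmund U a) (pullback_dz F Phi) ->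
  let A k p := complex.Re (pullback_dz F Phi p 0 k) in
  let B k p := complex.Im (pullback_dz F Phi p 0 k) in
  forall p k, U p ->
    B ix p * 'D_(std_basis ix) (A k) p + B iy p * 'D_(std_basis iy) (A k) p +
      B it p * 'D_(std_basis it) (A k) p =
    A ix p * 'D_(std_basis ix) (B k) p + A iy p * 'D_(std_basis iy) (B k) p +
      A it p * 'D_(std_basis it) (B k) p.
Proof.
move=> a1 [oU oW FK _ C1Phi] HZ A B p k Up.
have W w : (F @` U) w -> U (Phi w) /\ F (Phi w) = w.
  by move=> [q Uq <-]; rewrite FK.
have hA j : holder_zygmund U a (A j) by have [] := HZ j.
have hB j : holder_zygmund U a (B j) by have [] := HZ j.
pose phi w : R := Phi w 0 k.
have dPhi w : (F @` U) w -> differentiable Phi w by move=> /C1Phi[].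
have ex w j : (F @` U) w -> ('D_(std_basis ix) Phi w) 0 j = 2 * A j (Phi w).
  by move=> /W[_ E]; rewrite (dz_entry Phi w j).1 /A /pullback_dz E.
have ey w j : (F @` U) w -> ('D_(std_basis iy) Phi w) 0 j = - (2 * B j (Phi w)).
  by move=> /W[_ E]; rewrite (dz_entry Phi w j).2 /B /pullback_dz E.
have dphi w v : (F @` U) w -> is_derive w v phi (('D_v Phi w) 0 k).
  move=> Ww; have D := diff_derivable (v := v) (dPhi w Ww).
  apply: DeriveDef; first by move/derivable_mxP: D; exact.
  by rewrite (derive_mx D) mxE.
pose GA q := 2 * \sum_j - (2 * B j q) * 'D_(std_basis j) (A k) q.
pose GB q := - (2 * \sum_j 2 * A j q * 'D_(std_basis j) (B k) q).
have nW w : (F @` U) w -> nbhs w (F @` U) by move=> Ww; exact: open_nbhs_nbhs.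
have Eu w : (F @` U) w -> {near w, 2 *: (A k \o Phi) =1 'D_(std_basis ix) phi}.
  move=> /nW; apply: filterS => w' Ww'; have [_ ->] := dphi w' (std_basis ix) Ww'.
  by rewrite ex.
have Ev w : (F @` U) w -> {near w, - (2 *: (B k \o Phi)) =1 'D_(std_basis iy) phi}.
  move=> /nW; apply: filterS => w' Ww'; have [_ ->] := dphi w' (std_basis iy) Ww'.
  by rewrite ey.
have Duv w : (F @` U) w ->
    is_derive w (std_basis iy) ('D_(std_basis ix) phi) (GA (Phi w)).
  move=> Ww; apply: (near_eq_is_derive (Eu w Ww)).
  have dA := holder_zygmund_differentiable oU a1 (hA k) (W w Ww).1.
  have H := is_derive_comp_row (v := std_basis iy) dA (dPhi w Ww) erefl.
  apply: is_derive_eq; rewrite /GA /GRing.scale /=.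
  by congr (_ * _); apply: eq_bigr => j _; rewrite ey.
have Dvu w : (F @` U) w ->
    is_derive w (std_basis ix) ('D_(std_basis iy) phi) (GB (Phi w)).
  move=> Ww; apply: (near_eq_is_derive (Ev w Ww)).
  have dB := holder_zygmund_differentiable oU a1 (hB k) (W w Ww).1.
  have H := is_derive_comp_row (v := std_basis ix) dB (dPhi w Ww) erefl.
  apply: is_derive_eq.
  rewrite /GB /GRing.scale /=.
  by congr (- (_ * _)); apply: eq_bigr => j _; rewrite ex.
have Wp : (F @` U) (F p) by exists p.
have Php : Phi (F p) = p by exact: FK.
have cPhi : {for F p, continuous Phi}.
  exact: differentiable_continuous (dPhi _ Wp).
have cterm (P Q : 'rV[R]_3 -> R) : {for p, continuous P} -> {for p, continuous Q} ->
    {for p, continuous (fun q => P q * Q q)} by exact: continuousM.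
have cdA j : {for p, continuous ('D_(std_basis j) (A k))}.
  exact: holder_zygmund_partial_continuous a1 (hA k) _ Up.
have cdB j : {for p, continuous ('D_(std_basis j) (B k))}.
  exact: holder_zygmund_partial_continuous a1 (hB k) _ Up.
have cA j : {for p, continuous (A j)} by have [_] := holder_zygmund_bounded (hA j); exact.
have cB j : {for p, continuous (B j)} by have [_] := holder_zygmund_bounded (hB j); exact.
have cst2 : {for p, continuous (cst 2 : 'rV[R]_3 -> R)} by exact: cst_continuous.
have cGA : {for p, continuous GA}.
  apply: (cterm (cst 2)); first exact: cst2.
  have T j : {for p, continuous (fun q => - (2 * B j q) * 'D_(std_basis j) (A k) q)}.
    apply: (cterm (fun q => - (2 * B j q))); last exact: cdA.
    by apply: continuousN; exact: (cterm (cst 2)).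
  have -> : (fun q => \sum_j - (2 * B j q) * 'D_(std_basis j) (A k) q) =
     (fun q => - (2 * B ix q) * 'D_(std_basis ix) (A k) q) +
     (fun q => - (2 * B iy q) * 'D_(std_basis iy) (A k) q) +
     (fun q => - (2 * B it q) * 'D_(std_basis it) (A k) q).
    by apply/funext => q; rewrite sum3.
  by apply: continuousD; [apply: continuousD|].
have cGB : {for p, continuous GB}.
  apply: continuousN; apply: (cterm (cst 2)); first exact: cst2.
  have T j : {for p, continuous (fun q => 2 * A j q * 'D_(std_basis j) (B k) q)}.
    apply: (cterm (fun q => 2 * A j q)); last exact: cdB.
    exact: (cterm (cst 2)).
  have -> : (fun q => \sum_j 2 * A j q * 'D_(std_basis j) (B k) q) =
     (fun q => 2 * A ix q * 'D_(std_basis ix) (B k) q) +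
     (fun q => 2 * A iy q * 'D_(std_basis iy) (B k) q) +
     (fun q => 2 * A it q * 'D_(std_basis it) (B k) q).
    by apply/funext => q; rewrite sum3.
  by apply: continuousD; [apply: continuousD|].
have ccomp (G H : 'rV[R]_3 -> R) : {for p, continuous G} ->
    {near F p, G \o Phi =1 H} -> {for F p, continuous H}.
  move=> cG GH; rewrite /continuous_at; apply: cvg_trans (near_eq_cvg GH) _.
  rewrite -(nbhs_singleton GH); apply: (continuous_comp cPhi).
  by rewrite Php.
have EA : 'D_(std_basis iy) ('D_(std_basis ix) phi) (F p) = GA p.
  by have [_ E] := Duv _ Wp; rewrite Php in E; exact: E.
have EB : 'D_(std_basis ix) ('D_(std_basis iy) phi) (F p) = GB p.
  by have [_ E] := Dvu _ Wp; rewrite Php in E; exact: E.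
have : GA p = GB p.
  apply: etrans (esym EA) _; apply: etrans _ EB; apply: derive_comm.
  - have := nW _ Wp; apply: filterS => w Ww; split; first by have [] := dphi w (std_basis ix) Ww.
    split; first by have [] := dphi w (std_basis iy) Ww.
    by split; [have [] := Duv w Ww | have [] := Dvu w Ww].
  - apply: ccomp cGA _; have := nW _ Wp; apply: filterS => w Ww.
    by have [_ E] := Duv w Ww; exact: esym E.
  - apply: ccomp cGB _; have := nW _ Wp; apply: filterS => w Ww.
    by have [_ E] := Dvu w Ww; exact: esym E.
rewrite /GA /GB.
have -> : \sum_j - (2 * B j p) * 'D_(std_basis j) (A k) p =
    - (2 * \sum_j B j p * 'D_(std_basis j) (A k) p).
  by rewrite mulr_sumr -sumrN; apply: eq_bigr => j _; rewrite mulNr mulrA.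
have -> : \sum_j 2 * A j p * 'D_(std_basis j) (B k) p =
    2 * \sum_j A j p * 'D_(std_basis j) (B k) p.
  by rewrite mulr_sumr; apply: eq_bigr => j _; rewrite mulrA.
rewrite mulrN => /oppr_inj.
have n2 : (2 : R) != 0 by rewrite pnatr_eq0.
move=> /(mulfI n2)/(mulfI n2) E.
by apply: etrans (etrans (esym (sum3 _)) E) (sum3 _).
Qed.

(* The two commutation identities form a linear system of determinant
   [A ^ 2 + B ^ 2] in the defects of the two equations. *)
Let chart_algebra (A B r Ax Ay Bx By rx ry fR fI tR tI fRx fRy fIx fIy z1 z2 z3 z4 : R) :
  A ^+ 2 + B ^+ 2 != 0 ->
  fR = r * A - B -> fI = A + r * B -> tR = 0 -> tI = 0 ->
  fRx = r * Ax + A * rx - Bx -> fRy = r * Ay + A * ry - By ->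
  fIx = Ax + (r * Bx + B * rx) -> fIy = Ay + (r * By + B * ry) ->
  B * Ax + fI * Ay + tI * z1 = A * Bx + fR * By + tR * z2 ->
  B * fRx + fI * fRy + tI * z3 = A * fIx + fR * fIy + tR * z4 ->
  [/\ A ^+ 2 + B ^+ 2 != 0, Ax + By = ry * A - r * Ay & Bx - Ay = ry * B - r * By].
Proof.
move=> N0 -> -> -> -> -> -> -> ->; rewrite !mul0r !addr0 => C0 C1.
pose E1 := Ax + r * Ay + By - ry * A; pose E2 := Bx + r * By - Ay - ry * B.
have h0 : B * E1 - A * E2 = 0.
  transitivity ((B * Ax + (A + r * B) * Ay) - (A * Bx + (r * A - B) * By)).
    by rewrite /E1 /E2; ring.
  by rewrite C0 subrr.
have h1 : A * E1 + B * E2 = 0.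
  transitivity (r * (B * E1 - A * E2) -
      ((B * (r * Ax + A * rx - Bx) + (A + r * B) * (r * Ay + A * ry - By)) -
       (A * (Ax + (r * Bx + B * rx)) + (r * A - B) * (Ay + (r * By + B * ry))))).
    by rewrite /E1 /E2; ring.
  by rewrite C1 subrr h0 mulr0 subr0.
have e1 : E1 = 0.
  apply: (mulfI N0); rewrite mulr0.
  transitivity (B * (B * E1 - A * E2) + A * (A * E1 + B * E2)); first by ring.
  by rewrite h0 h1 !mulr0 addr0.
have e2 : E2 = 0.
  apply: (mulfI N0); rewrite mulr0.
  transitivity (B * (A * E1 + B * E2) - A * (B * E1 - A * E2)); first by ring.
  by rewrite h0 h1 !mulr0 subr0.
by split=> //; move: e1 e2; rewrite /E1 /E2; lra.
Qed.

(** A field [h (d/dx + (r + i) d/dy)] of the form d/dz satisfies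
    h_x + (r - i) h_y = r_y h. *)
Lemma chart_equations (r : 'rV[R]_3 -> R) (U : set 'rV[R]_3)
    (F Phi : 'rV[R]_3 -> 'rV[R]_3) (a : R) :
  1 < a -> (forall j p, derivable r p (std_basis j)) -> C1_chart U F Phi ->
  (forall p, U p -> leaf_bundle r p = <[pullback_dz F Phi p]>%VS) ->
  componentwise (holder_zygmund U a) (pullback_dz F Phi) ->
  let A p := complex.Re (pullback_dz F Phi p 0 ix) in
  let B p := complex.Im (pullback_dz F Phi p 0 ix) in
  forall p, U p -> [/\ A p ^+ 2 + B p ^+ 2 != 0,
    'D_(std_basis ix) A p + 'D_(std_basis iy) B p =
      'D_(std_basis iy) r p * A p - r p * 'D_(std_basis iy) A p &
    'D_(std_basis ix) B p - 'D_(std_basis iy) A p =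
      'D_(std_basis iy) r p * B p - r p * 'D_(std_basis iy) B p].
Proof.
move=> a1 dr ch SU HZ A B p Up; have [oU _ _ _ _] := ch.
set V := pullback_dz F Phi in A B SU HZ *.
have inV q : U q -> V q 0 iy = (r q +i* 1) * V q 0 ix /\ V q 0 it = 0.
  by move=> Uq; apply/mem_leaf; rewrite -/(leaf_bundle r q) SU // memv_line.
have Ay q : U q -> complex.Re (V q 0 iy) = r q * A q - B q /\
    complex.Im (V q 0 iy) = A q + r q * B q.
  move=> /inV[-> _]; rewrite /A /B; case: (V q 0 ix) => x y /=.
  by split; ring.
have N0 : A p ^+ 2 + B p ^+ 2 != 0.
  apply/negP; rewrite paddr_eq0 ?sqr_ge0 // !sqrf_eq0 => /andP[/eqP a0 /eqP b0].
  have Vx : V p 0 ix = 0.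
    by move: a0 b0; rewrite /A /B; case: (V p 0 ix) => x y /= -> ->.
  have V0 : V p = 0.
    have [Vy Vt] := inV p Up; apply/rowP; apply: ord3_ind; rewrite [RHS]mxE //.
    by rewrite -/iy Vy Vx mulr0.
  have := @leaf_bundle_rank R r p; rewrite SU // V0 dim_vline eqxx //.
have hA : holder_zygmund U a A by have [] := HZ ix.
have hB : holder_zygmund U a B by have [] := HZ ix.
have dA j := derivableP ((let: And3 h _ _ := holder_zygmund_inv a1 hA in h) j p Up).
have dB j := derivableP ((let: And3 h _ _ := holder_zygmund_inv a1 hB in h) j p Up).
have dR j := derivableP (dr j p).
have nU : nbhs p U by exact: open_nbhs_nbhs.
have D1 j : 'D_(std_basis j) (fun q => complex.Re (V q 0 iy)) p =
    r p * 'D_(std_basis j) A p + A p * 'D_(std_basis j) r p - 'D_(std_basis j) B p.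
  have E : {near p, r * A - B =1 (fun q => complex.Re (V q 0 iy))}.
    by apply: filterS nU => q /Ay[-> _].
  have H : is_derive p (std_basis j) (r * A - B) (r p * 'D_(std_basis j) A p +
     A p * 'D_(std_basis j) r p - 'D_(std_basis j) B p).
    by apply: is_deriveB; apply: is_deriveM.
  by have [_ ->] := near_eq_is_derive E H.
have D2 j : 'D_(std_basis j) (fun q => complex.Im (V q 0 iy)) p =
    'D_(std_basis j) A p + (r p * 'D_(std_basis j) B p + B p * 'D_(std_basis j) r p).
  have E : {near p, A + r * B =1 (fun q => complex.Im (V q 0 iy))}.
    by apply: filterS nU => q /Ay[_ ->].
  have H : is_derive p (std_basis j) (A + r * B) ('D_(std_basis j) A p +
     (r p * 'D_(std_basis j) B p + B p * 'D_(std_basis j) r p)).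
    by apply: is_deriveD; apply: is_deriveM.
  by have [_ ->] := near_eq_is_derive E H.
have [Vy Vt] := inV p Up; have [y1 y2] := Ay p Up.
have [t1 t2] : complex.Re (V p 0 it) = 0 /\ complex.Im (V p 0 it) = 0 by rewrite Vt.
have C0 : B p * 'D_(std_basis ix) A p +
      complex.Im (V p 0 iy) * 'D_(std_basis iy) A p +
      complex.Im (V p 0 it) * 'D_(std_basis it) A p =
    A p * 'D_(std_basis ix) B p +
      complex.Re (V p 0 iy) * 'D_(std_basis iy) B p +
      complex.Re (V p 0 it) * 'D_(std_basis it) B p.
  exact: (chart_commute a1 ch HZ ix Up).
have C1 : B p * 'D_(std_basis ix) (fun q => complex.Re (V q 0 iy)) p +
      complex.Im (V p 0 iy) * 'D_(std_basis iy) (fun q => complex.Re (V q 0 iy)) p +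
      complex.Im (V p 0 it) * 'D_(std_basis it) (fun q => complex.Re (V q 0 iy)) p =
    A p * 'D_(std_basis ix) (fun q => complex.Im (V q 0 iy)) p +
      complex.Re (V p 0 iy) * 'D_(std_basis iy) (fun q => complex.Im (V q 0 iy)) p +
      complex.Re (V p 0 it) * 'D_(std_basis it) (fun q => complex.Im (V q 0 iy)) p.
  exact: (chart_commute a1 ch HZ iy Up).
exact: (chart_algebra N0 y1 y2 t1 t2 (D1 ix) (D1 iy) (D2 ix) (D2 iy) C0 C1).
Qed.

End chart_equations.

(** * Cylindrical coordinates *)

Section cylindrical_coordinates.
Context {R : realType}.
Let ix : 'I_3 := inord 0.
Let iy : 'I_3 := inord 1.
Let it : 'I_3 := inord 2.

(** The point with cylindrical coordinates [r], [t], [s]. *)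
Definition cyl (s r t : R) : 'rV[R]_3 :=
  (r * cos t) *: std_basis ix + (r * sin t) *: std_basis iy + s *: std_basis it.

Lemma cylE s r t : [/\ cyl s r t 0 ix = r * cos t, cyl s r t 0 iy = r * sin t &
  cyl s r t 0 it = s].
Proof.
by split; rewrite !mxE !eqxx /= !inord3_eq // !(mulr1, mulr0, addr0, add0r).
Qed.

Lemma sqdist_cyl s r t : sqdist (cyl s r t) = r ^+ 2 + s ^+ 2.
Proof.
have [Ex Ey Et] := cylE s r t; rewrite /sqdist -/ix -/iy -/it Ex Ey Et.
by rewrite !exprMn -mulrDr cos2Dsin2 mulr1.
Qed.

Lemma cyl_shift s c r t : cyl s r t - c *: std_basis it = cyl (s - c) r t :> 'rV[R]_3.
Proof. by rewrite /cyl -/it scalerBl addrA. Qed.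

Lemma cyl_norm s r t d : `|s| <= d -> `|r| <= d -> `|cyl s r t : 'rV[R]_3| <= d.
Proof.
move=> sd rd; have [Ex Ey Et] := cylE s r t.
apply: norm_le_coord; first exact: le_trans (normr_ge0 s) sd.
apply: ord3_ind; rewrite ?Ex ?Ey ?Et // normrM -[leRHS]mulr1 ler_pM //.
  exact: cos_max.
exact: sin_max.
Qed.

Lemma is_derive_row (n : nat) (g : R -> 'rV[R]_n) (t : R) (g' : 'rV[R]_n) :
  (forall j, is_derive t 1 (fun u => g u 0 j) (g' 0 j)) -> is_derive t 1 g g'.
Proof.
move=> H; have D : derivable g t 1.
  by apply/derivable_mxP => i j; rewrite (ord1 i); have [] := H j.
apply: DeriveDef => //; rewrite (derive_mx D); apply/rowP => j; rewrite mxE.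
by have [_ ->] := H j.
Qed.

Let is_derive_lin2 (f g : R -> R) (k l m r f' g' : R) :
  is_derive r 1 f f' -> is_derive r 1 g g' ->
  is_derive r 1 (fun u => k * f u + l * g u + m) (k * f' + l * g').
Proof.
move=> hf hg.
have H := is_deriveD (is_deriveD (is_deriveZ k hf) (is_deriveZ l hg))
  (is_derive_cst m r 1).
by move: H; rewrite addr0.
Qed.

Lemma is_derive_cyl_radial (s r t : R) : is_derive r 1 (fun u => cyl s u t)
  (cos t *: std_basis ix + sin t *: std_basis iy : 'rV[R]_3).
Proof.
apply: is_derive_row => j.
set v := (X in is_derive _ _ _ X).
have -> : (fun u => cyl s u t 0 j) = (fun u =>
    (cos t * (std_basis ix : 'rV[R]_3) 0 j) * id u +
    (sin t * (std_basis iy : 'rV[R]_3) 0 j) * id u +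
     s * (std_basis it : 'rV[R]_3) 0 j).
  by apply/funext => u; rewrite !mxE /=; ring.
have -> : v = cos t * (std_basis ix : 'rV[R]_3) 0 j + sin t * (std_basis iy : 'rV[R]_3) 0 j.
  by rewrite /v !mxE.
move: ((std_basis ix : 'rV[R]_3) 0 j) ((std_basis iy : 'rV[R]_3) 0 j)
  ((std_basis it : 'rV[R]_3) 0 j) => x y z.
by have := is_derive_lin2 (cos t * x) (sin t * y) (s * z) (is_derive_id r 1)
  (is_derive_id r 1); rewrite !mulr1.
Qed.

Lemma is_derive_cyl_angular (s r t : R) : is_derive t 1 (cyl s r)
  (- (r * sin t) *: std_basis ix + (r * cos t) *: std_basis iy : 'rV[R]_3).
Proof.
apply: is_derive_row => j.
set v := (X in is_derive _ _ _ X).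
have -> : (fun u => cyl s r u 0 j) = (fun u =>
    (r * (std_basis ix : 'rV[R]_3) 0 j) * cos u +
    (r * (std_basis iy : 'rV[R]_3) 0 j) * sin u +
     s * (std_basis it : 'rV[R]_3) 0 j).
  by apply/funext => u; rewrite !mxE /=; ring.
have -> : v = - (r * sin t) * (std_basis ix : 'rV[R]_3) 0 j +
    r * cos t * (std_basis iy : 'rV[R]_3) 0 j.
  by rewrite /v !mxE.
move: ((std_basis ix : 'rV[R]_3) 0 j) ((std_basis iy : 'rV[R]_3) 0 j)
  ((std_basis it : 'rV[R]_3) 0 j) => x y z.
have H := is_derive_lin2 (r * x) (r * y) (s * z) (is_derive_cos t) (is_derive_sin t).
by apply: is_derive_eq H _; ring.
Qed.

Lemma continuous_cyl (s r : R) : continuous (cyl s r : R -> 'rV[R]_3).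
Proof.
move=> t; apply: differentiable_continuous; apply/derivable1_diffP.
by have [] := is_derive_cyl_angular s r t.
Qed.

(** The derivatives of a function in the plane polar coordinates. *)
Lemma is_derive_polar (f : 'rV[R]_3 -> R) (s r t : R) : differentiable f (cyl s r t) ->
  is_derive r 1 (fun u => f (cyl s u t))
    (cos t * 'D_(std_basis ix) f (cyl s r t) +
     sin t * 'D_(std_basis iy) f (cyl s r t)) /\
  is_derive t 1 (fun u => f (cyl s r u))
    (- (r * sin t) * 'D_(std_basis ix) f (cyl s r t) +
     r * cos t * 'D_(std_basis iy) f (cyl s r t)).
Proof.
move=> df.
have row3 (a b : R) : let v : 'rV[R]_3 := a *: std_basis ix + b *: std_basis iy in
    [/\ v 0 ix = a, v 0 iy = b & v 0 it = 0].
  by split; rewrite !mxE !eqxx /= !inord3_eq // !(mulr1, mulr0, addr0, add0r).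
split.
- have [d e] := is_derive_cyl_radial s r t.
  have dg : differentiable (fun u => cyl s u t : 'rV[R]_3) r by apply/derivable1_diffP.
  apply: is_derive_eq (is_derive_comp_row (g := fun u => cyl s u t) df dg e) _.
  have [x y z] := row3 (cos t) (sin t).
  by rewrite sum3 x y z mul0r addr0.
- have [d e] := is_derive_cyl_angular s r t.
  have dg : differentiable (cyl s r : R -> 'rV[R]_3) t by apply/derivable1_diffP.
  apply: is_derive_eq (is_derive_comp_row (g := cyl s r) df dg e) _.
  have [x y z] := row3 (- (r * sin t)) (r * cos t).
  by rewrite sum3 x y z mul0r addr0.
Qed.

Lemma uniform_bound (n : nat) (P : 'I_n -> R -> Prop) :
  (forall j M M', M <= M' -> P j M -> P j M') -> (forall j, exists M, P j M) ->
  exists2 M, 0 <= M & forall j, P j M.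
Proof.
move=> mono /choice[M HM]; exists (\sum_j `|M j|); first exact: sumr_ge0.
move=> j; apply: mono (HM j); rewrite (bigD1 j) //=.
by apply: le_trans (ler_norm _) _; rewrite lerDl sumr_ge0.
Qed.

End cylindrical_coordinates.

(** * The coefficient of the structure *)

Section leaf_coefficient.
Context {R : realType}.
Let ix : 'I_3 := inord 0.
Let iy : 'I_3 := inord 1.
Let it : 'I_3 := inord 2.

(** The coefficient [s_+ ^ a y ^ 2 / (x ^ 2 + y ^ 2 + s ^ 2)]. *)
Definition leaf_coef (a : R) : 'rV[R]_3 -> R := half_monomial a 0 2 1.

Lemma leaf_coef_class a : plane_class a (leaf_coef a).
Proof. by apply: plane_class_monomial => //; rewrite addrK. Qed.

Lemma leaf_coef_holder_zygmund a p e : 0 < a ->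
  holder_zygmund (ball p e) a (leaf_coef a).
Proof.
move=> a0; apply: plane_class_holder_zygmund (leaf_coef_class a) a0 _.
exists (p 0 it + e) => q; rewrite -ball_normE /= => /ltW pq.
have := coord_le_norm (p - q) it; rewrite !mxE ler_norml => /andP[h _].
by move: (le_trans h (lexx _)) pq; rewrite -/it; lra.
Qed.

Lemma leaf_coef_derivable a : 1 < a ->
  forall j p, derivable (leaf_coef a) p (std_basis j).
Proof.
move=> a1 j p; have a0 := lt_trans ltr01 a1.
have [D _ _] := holder_zygmund_inv a1 (leaf_coef_holder_zygmund p 1 a0).
by apply: D; exact: ballxx.
Qed.

Lemma leaf_coef_dy a (p : 'rV[R]_3) : 0 < p 0 it ->
  'D_(std_basis iy) (leaf_coef a) p = p 0 it `^ a *
    (2 * p 0 iy * (p 0 ix ^+ 2 + p 0 it ^+ 2) / sqdist p ^+ 2).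
Proof.
move=> s0; have [_ ->] := half_monomial_is_derive a 0 2 1 (std_basis iy) s0.
have d0 := lt0r_neq0 (sqdist_gt0 s0).
rewrite /half_monomial_diff /half_monomial -/ix -/iy -/it s0 !mxE !eqxx /= !inord3_eq //=.
have sq : sqdist p = p 0 ix ^+ 2 + p 0 iy ^+ 2 + p 0 it ^+ 2 by [].
set w := (sqdist p)^-1.
have -> : p 0 ix ^+ 2 + p 0 it ^+ 2 = sqdist p - p 0 iy ^+ 2 by rewrite sq; ring.
rewrite -[in RHS]exprVn -/w.
have ww : sqdist p * w = 1 by rewrite mulfV.
have -> : 2 * p 0 iy * (sqdist p - p 0 iy ^+ 2) * w ^+ 2 =
   2 * p 0 iy * (sqdist p * w) * w - 2 * p 0 iy ^+ 3 * w ^+ 2 by ring.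
rewrite ww !(mulr0, mul0r, add0r, addr0, oppr0).
by move: (p 0 it `^ a) => S; ring.
Qed.

Lemma leaf_coef_dy0 a (p : 'rV[R]_3) : 1 < a -> p 0 it <= 0 ->
  'D_(std_basis iy) (leaf_coef a) p = 0.
Proof.
move=> a1 s0.
by have [_ ->] := plane_class_is_derive0 (std_basis iy) (leaf_coef_class a) a1 s0.
Qed.

(** On a circle of radius [r >= s] in the plane of height [s], the derivative
    d/dy of the coefficient is O(s ^ a / r), and its product with [sin] is
    bounded below by a nonnegative function with a mean of that same order. *)
Lemma leaf_coef_cyl_dy a s r t : 0 < s < r ->
  let y := 'D_(std_basis iy) (leaf_coef a) (cyl s r t) in
  `|y| <= 2 * s `^ a / r /\
  s `^ a * (sin t * cos t) ^+ 2 / (2 * r) <= sin t * y.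
Proof.
move=> /andP[s0 sr]; have r0 := lt_trans s0 sr.
have [Ex Ey Et] := cylE s r t.
rewrite leaf_coef_dy ?Et // sqdist_cyl Ex Ey /=.
have S0 := powR_ge0 s a; set S := s `^ a in S0 *.
have cs := cos2Dsin2 t; set c := cos t in cs *; set x := sin t in cs *.
set d := r ^+ 2 + s ^+ 2.
have d0 : 0 < d by rewrite ltr_wpDl ?exprn_gt0 // sqr_ge0.
have x1 : `|x| <= 1.
  by rewrite -(@ler_pXn2r _ 2) ?nnegrE // expr1n real_normK ?num_real // -cs lerDr sqr_ge0.
have rd : r ^+ 2 <= d by rewrite lerDl sqr_ge0.
have dr : d <= 2 * r ^+ 2.
  by rewrite /d mulr2n mulrDl !mul1r lerD2l; rewrite ler_sqr ?nnegrE ltW.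
have xcd : (r * c) ^+ 2 + s ^+ 2 <= d.
  by rewrite /d lerD2r exprMn ler_piMr ?sqr_ge0 // -cs lerDl sqr_ge0.
split.
  have m0 : 0 <= (r * c) ^+ 2 + s ^+ 2 by rewrite addr_ge0 ?sqr_ge0.
  set m := _ + _ in m0 xcd *.
  have h : r * m / d ^+ 2 <= r^-1.
    rewrite ler_pdivrMr ?exprn_gt0 // -(ler_pM2l r0) !mulrA divff ?gt_eqF // mul1r.
    by rewrite -[r * r]expr2 ler_pM ?sqr_ge0.
  have h0 : 0 <= r * m / d ^+ 2 by rewrite divr_ge0 ?sqr_ge0 // mulr_ge0 // ltW.
  have -> : S * (2 * (r * x) * m / d ^+ 2) = 2 * S * (x * (r * m / d ^+ 2)) by ring.
  rewrite normrM ger0_norm ?mulr_ge0 // ler_wpM2l ?mulr_ge0 //.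
  by rewrite normrM (ger0_norm h0) -[leRHS]mul1r ler_pM.
have -> : x * (S * (2 * (r * x) * ((r * c) ^+ 2 + s ^+ 2) / d ^+ 2)) =
   S * (2 * r * x ^+ 2 * ((r * c) ^+ 2 + s ^+ 2) / d ^+ 2) by ring.
rewrite -mulrA ler_wpM2l //.
apply: (@le_trans _ _ (2 * r * x ^+ 2 * (r * c) ^+ 2 / d ^+ 2)); last first.
  rewrite ler_wpM2r ?invr_ge0 ?sqr_ge0 // ler_wpM2l ?lerDl ?sqr_ge0 //.
  by rewrite mulr_ge0 ?sqr_ge0 // mulr_ge0 // ltW.
have -> : 2 * r * x ^+ 2 * (r * c) ^+ 2 / d ^+ 2 =
    (x * c) ^+ 2 * (2 * r ^+ 3 / d ^+ 2) by ring.
rewrite ler_wpM2l ?sqr_ge0 // ler_pdivlMr ?exprn_gt0 //.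
rewrite mulrC ler_pdivrMr ?mulr_gt0 //.
have -> : 2 * r ^+ 3 * (2 * r) = (2 * r ^+ 2) ^+ 2 by ring.
by rewrite ler_sqr ?nnegrE ?mulr_ge0 ?sqr_ge0 // ltW.
Qed.

(** The main term of the polar equation: [f] and [y] stand for the coefficient
    and its derivative d/dy, [c] and [x] for the cosine and the sine, [S] for
    s ^ a, [A0] and [B0] for the values of [A] and [B] at the origin. *)
Lemma obstruction_algebra (A0 B0 A B Ay By c x y f S r M : R) :
  0 <= S -> 0 < r -> 0 <= M -> `|c| <= 1 -> `|x| <= 1 -> `|y| <= 2 * S / r ->
  S * (x * c) ^+ 2 / (2 * r) <= x * y -> `|f| <= S ->
  `|A - A0| <= 3 * M * r -> `|B - B0| <= 3 * M * r -> `|Ay| <= M -> `|By| <= M ->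
  c * (B0 * (y * A - f * Ay) - A0 * (y * B - f * By)) -
  x * (A0 * (y * A - f * Ay) + B0 * (y * B - f * By)) <=
  - ((A0 ^+ 2 + B0 ^+ 2) * S / 2 * (x * c) ^+ 2 / r) +
    14 * (`|A0| + `|B0|) * M * S.
Proof.
move=> S0 r0 M0 c1 x1 yS xyS fS AA BB AyM ByM.
have yA (z : R) : `|z| <= 3 * M * r -> `|y * z| <= 6 * M * S.
  move=> zr; rewrite normrM; apply: le_trans (ler_pM _ _ yS zr) _ => //.
  have -> : 2 * S / r * (3 * M * r) = 6 * M * S by field; rewrite gt_eqF.
  exact: lexx.
have fA (z : R) : `|z| <= M -> `|f * z| <= M * S.
  by move=> zM; rewrite normrM mulrC ler_pM.
have T (z w : R) : `|z| <= 6 * M * S -> `|w| <= M * S -> `|z - w| <= 7 * M * S.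
  move=> h1 h2; apply: le_trans (ler_normB _ _) _.
  by apply: le_trans (lerD h1 h2) _; rewrite le_eqVlt; apply/orP; left; apply/eqP; ring.
have TA := T _ _ (yA _ AA) (fA _ AyM).
have TB := T _ _ (yA _ BB) (fA _ ByM).
set u := y * (A - A0) - f * Ay in TA; set v := y * (B - B0) - f * By in TB.
have -> : c * (B0 * (y * A - f * Ay) - A0 * (y * B - f * By)) -
  x * (A0 * (y * A - f * Ay) + B0 * (y * B - f * By)) =
  - ((A0 ^+ 2 + B0 ^+ 2) * (x * y)) + (c * (B0 * u - A0 * v) - x * (A0 * u + B0 * v)).
  by rewrite /u /v; ring.
apply: lerD.
  rewrite lerN2 -!mulrA ler_wpM2l ?addr_ge0 ?sqr_ge0 //.
  apply: le_trans xyS; rewrite le_eqVlt; apply/orP; left; apply/eqP; field.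
  by rewrite gt_eqF.
apply: le_trans (ler_norm _) _; apply: le_trans (ler_normB _ _) _.
set K := `|A0| * (7 * M * S) + `|B0| * (7 * M * S).
have bnd (z1 z2 : R) : `|z1| <= 1 -> `|z2| <= K -> `|z1 * z2| <= K.
  by move=> h1 h2; rewrite normrM -[leRHS]mul1r ler_pM.
have h1 : `|c * (B0 * u - A0 * v)| <= K.
  apply: bnd => //; apply: le_trans (ler_normB _ _) _; rewrite addrC !normrM.
  by apply: lerD; apply: ler_wpM2l.
have h2 : `|x * (A0 * u + B0 * v)| <= K.
  apply: bnd => //; apply: le_trans (ler_normD _ _) _; rewrite !normrM.
  by apply: lerD; apply: ler_wpM2l.
apply: le_trans (lerD h1 h2) _; rewrite le_eqVlt; apply/orP; left.
by apply/eqP; rewrite /K; ring.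
Qed.

End leaf_coefficient.

(** * The obstruction *)

Section obstruction.
Context {R : realType}.
Let ix : 'I_3 := inord 0.
Let iy : 'I_3 := inord 1.
Let it : 'I_3 := inord 2.
Let e : 'rV[R]_3 := std_basis it.

Lemma gradient_lipschitz (U : set 'rV[R]_3) (f : 'rV[R]_3 -> R) (d M : R)
    (p : 'rV[R]_3) :
  (forall q : 'rV[R]_3, `|q| < d -> U q) ->
  (forall q, U q -> differentiable f q) ->
  (forall j q, U q -> `|'D_(std_basis j) f q| <= M) -> `|p| < d ->
  `|f p - f 0| <= 3 * M * `|p|.
Proof.
move=> dU df bf pd.
have seg u : 0 <= u <= 1 -> U (0 + u *: p).
  move=> /andP[u0 u1]; apply: dU; rewrite add0r normrZ ger0_norm //.
  by apply: le_lt_trans pd; rewrite ler_piMl.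
have [|u] := @MVT_dir _ _ f (fun q => \sum_j p 0 j * 'D_(std_basis j) f q) 0 p 1.
  move=> u; rewrite min_l // max_r // => /seg Uu; have D := df _ Uu.
  by apply: DeriveDef; [exact: diff_derivable | exact: derive_partials].
rewrite min_l // max_r // scale1r mul1r add0r => /seg Uu ->.
have := @sum_norm_le R p (fun j => 'D_(std_basis j) f (0 + u *: p)) (fun=> M)
  (fun j => bf j _ Uu).
by rewrite sumr_const card_ord mulrC -[M *+ 3]mulr_natl.
Qed.

(** The level [s] of the obstruction: [A + i B] is a solution, [m] the order of
    a backward difference which is O(s ^ a). *)
Lemma obstruction_level (a d M C s b : R) (m : nat) (U : set 'rV[R]_3)
    (A B : 'rV[R]_3 -> R) : let f := leaf_coef a in
  let N := A 0 ^+ 2 + B 0 ^+ 2 in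
  1 < a -> (forall q : 'rV[R]_3, `|q| < d -> U q) ->
  (forall q, U q -> differentiable A q) -> (forall q, U q -> differentiable B q) ->
  (forall j q, U q -> {for q, continuous ('D_(std_basis j) A)}) ->
  (forall j q, U q -> {for q, continuous ('D_(std_basis j) B)}) ->
  (forall j q, U q -> `|'D_(std_basis j) A q| <= M) ->
  (forall j q, U q -> `|'D_(std_basis j) B q| <= M) -> 0 <= M ->
  0 < s -> m.+1%:R * s < d ->
  (forall p, (forall t, 0 <= t <= m%:R * s -> U (p - t *: e)) ->
    `|bdiff e m s A p| <= C * s `^ a) ->
  (forall p, (forall t, 0 <= t <= m%:R * s -> U (p - t *: e)) ->
    `|bdiff e m s B p| <= C * s `^ a) ->
  (forall p, U p -> 'D_(std_basis ix) A p + 'D_(std_basis iy) B p =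
      'D_(std_basis iy) f p * A p - f p * 'D_(std_basis iy) A p) ->
  (forall p, U p -> 'D_(std_basis ix) B p - 'D_(std_basis iy) A p =
      'D_(std_basis iy) f p * B p - f p * 'D_(std_basis iy) B p) ->
  2 * s <= b -> b < d ->
  N / 2 / 8 * (ln b - ln (2 * s)) <=
    2 * ((`|A 0| + `|B 0|) * C) + 14 * (`|A 0| + `|B 0|) * M * (b - 2 * s).
Proof.
move=> f N a1 dU dA dB cA cB bA bB M0 s0 msd bdA bdB eq1 eq2 sb bd.
have S0 : 0 < s `^ a by exact: powR_gt0.
set S := s `^ a in S0 bdA bdB *.
have inU (r t c : R) : s < r < d -> 0 <= c <= m%:R * s -> U (cyl s r t - c *: e).
  move=> /andP[sr rd] /andP[c0 cm]; rewrite cyl_shift; apply: dU.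
  have r0 := lt_trans s0 sr.
  apply: (@le_lt_trans _ _ (Num.max (m.+1%:R * s) r)); last by rewrite gt_max msd.
  apply: cyl_norm; rewrite le_max; last by rewrite (ger0_norm (ltW r0)) lexx orbT.
  rewrite -natr1 mulrDl mul1r ler_norml; apply/orP; left.
  by move: s0 c0 cm; move: (m%:R * s) => w *; apply/andP; split; lra.
have inUj (r t : R) j : s < r < d -> (j <= m)%N -> U (cyl s r t - (j%:R * s) *: e).
  move=> h jm; apply: inU h _; rewrite mulr_ge0 ?(ltW s0) //=.
  by rewrite ler_pM2r // ler_nat.
have inU0 (r t : R) : s < r < d -> U (cyl s r t).
  by move=> h; have := inUj r t 0%N h isT; rewrite mul0r scale0r subr0.
pose P := bdiff e m s A; pose Q := bdiff e m s B.
pose gP j := bdiff e m s ('D_(std_basis j) A).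
pose gQ j := bdiff e m s ('D_(std_basis j) B).
have polar (F : 'rV[R]_3 -> R) : (forall q, U q -> differentiable F q) ->
    forall r t : R, s < r < d ->
    is_derive r 1 (fun u => bdiff e m s F (cyl s u t))
      (cos t * bdiff e m s ('D_(std_basis ix) F) (cyl s r t) +
       sin t * bdiff e m s ('D_(std_basis iy) F) (cyl s r t)) /\
    is_derive t 1 (fun u => bdiff e m s F (cyl s r u))
      (- (r * sin t) * bdiff e m s ('D_(std_basis ix) F) (cyl s r t) +
       r * cos t * bdiff e m s ('D_(std_basis iy) F) (cyl s r t)).
  move=> dF r t h.
  have D : differentiable (bdiff e m s F) (cyl s r t).
    by apply: differentiable_bdiff => j jm; apply: dF; exact: inUj.
  have DE k : 'D_(std_basis k) (bdiff e m s F) (cyl s r t) =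
      bdiff e m s ('D_(std_basis k) F) (cyl s r t).
    have H : is_derive (cyl s r t) (std_basis k) (bdiff e m s F)
        (bdiff e m s ('D_(std_basis k) F) (cyl s r t)).
      apply: is_derive_bdiff => j jm.
      by apply/derivableP/diff_derivable/dF; exact: inUj.
    by have [_ E] := H; exact: E.
  by have := is_derive_polar D; rewrite !DE.
have ccyl (F : 'rV[R]_3 -> R) (r : R) : s < r < d ->
    (forall q, U q -> {for q, continuous F}) ->
    continuous (fun t => bdiff e m s F (cyl s r t)).
  move=> h cF t; apply: (@continuous_comp _ _ _ (cyl s r) (bdiff e m s F)).
    exact: continuous_cyl.
  by apply: continuous_bdiff => j jm; apply: cF; exact: inUj.
(* [p - i q] is the product of [P + i Q] with the conjugate of [A 0 + i B 0],
   which makes the coefficient of the main term the real number [N] *)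
pose q (r t : R) := B 0 * P (cyl s r t) - A 0 * Q (cyl s r t).
pose p (r t : R) := A 0 * P (cyl s r t) + B 0 * Q (cyl s r t).
pose qr (r t : R) := B 0 * (cos t * gP ix (cyl s r t) + sin t * gP iy (cyl s r t)) -
  A 0 * (cos t * gQ ix (cyl s r t) + sin t * gQ iy (cyl s r t)).
pose pt (r t : R) :=
  A 0 * (- (r * sin t) * gP ix (cyl s r t) + r * cos t * gP iy (cyl s r t)) +
  B 0 * (- (r * sin t) * gQ ix (cyl s r t) + r * cos t * gQ iy (cyl s r t)).
have dq (r t : R) : s < r < d -> is_derive r 1 (q ^~ t) (qr r t).
  move=> h; have [hP _] := polar A dA r t h; have [hQ _] := polar B dB r t h.
  exact: (is_deriveB (is_deriveZ (B 0) hP) (is_deriveZ (A 0) hQ)).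
have dp (r t : R) : s < r < d -> is_derive t 1 (p r) (pt r t).
  move=> h; have [_ hP] := polar A dA r t h; have [_ hQ] := polar B dB r t h.
  exact: (is_deriveD (is_deriveZ (A 0) hP) (is_deriveZ (B 0) hQ)).
have cD (F G : R -> R) : continuous F -> continuous G ->
    continuous (fun t => F t + G t).
  by move=> cF cG t; apply: continuousD; [exact: cF|exact: cG].
have cBn (F G : R -> R) : continuous F -> continuous G ->
    continuous (fun t => F t - G t).
  by move=> cF cG t; apply: continuousB; [exact: cF|exact: cG].
have cM (F G : R -> R) : continuous F -> continuous G ->
    continuous (fun t => F t * G t).
  by move=> cF cG t; apply: continuousM; [exact: cF|exact: cG].
have cc (c : R) : continuous (fun _ : R => c) by move=> t; exact: cst_continuous.
have ccos : continuous (@cos R) by exact: continuous_cos.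
have csin : continuous (@sin R) by exact: continuous_sin.
have cP (r : R) : s < r < d -> continuous (fun t => P (cyl s r t)).
  by move=> h; apply: ccyl => // z Uz; exact: differentiable_continuous (dA z Uz).
have cQ (r : R) : s < r < d -> continuous (fun t => Q (cyl s r t)).
  by move=> h; apply: ccyl => // z Uz; exact: differentiable_continuous (dB z Uz).
have cgP (r : R) j : s < r < d -> continuous (fun t => gP j (cyl s r t)).
  by move=> h; apply: ccyl => // z Uz; exact: cA.
have cgQ (r : R) j : s < r < d -> continuous (fun t => gQ j (cyl s r t)).
  by move=> h; apply: ccyl => // z Uz; exact: cB.
have cq (r : R) : s < r < d -> continuous (q r).
  by move=> h; apply: cBn; apply: cM; [exact: cc|exact: cP|exact: cc|exact: cQ].
have cqr (r : R) : s < r < d -> continuous (qr r).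
  move=> h; have := (cgP r ix h, cgP r iy h, cgQ r ix h, cgQ r iy h).
  move=> [[[h1 h2] h3] h4].
  exact: (cBn _ _ (cM _ _ (cc _) (cD _ _ (cM _ _ ccos h1) (cM _ _ csin h2)))
                  (cM _ _ (cc _) (cD _ _ (cM _ _ ccos h3) (cM _ _ csin h4)))).
have cpt (r : R) : s < r < d -> continuous (pt r).
  move=> h; have := (cgP r ix h, cgP r iy h, cgQ r ix h, cgQ r iy h).
  move=> [[[h1 h2] h3] h4].
  have c1 : continuous (fun t => - (r * sin t)).
    by move=> t; exact: (continuousN (cM _ _ (cc r) csin t)).
  have c2 : continuous (fun t => r * cos t) by exact: cM.
  exact: (cD _ _ (cM _ _ (cc _) (cD _ _ (cM _ _ c1 h1) (cM _ _ c2 h2)))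
                 (cM _ _ (cc _) (cD _ _ (cM _ _ c1 h3) (cM _ _ c2 h4)))).
have bg (F : 'rV[R]_3 -> R) (r t : R) : s < r < d -> (forall z, U z -> `|F z| <= M) ->
    `|bdiff e m s F (cyl s r t)| <= 2 ^+ m * M.
  by move=> h bF; apply: bdiff_le => j jm; apply: bF; exact: inUj.
have lin2 (x y z w K : R) : `|z| <= K -> `|w| <= K ->
    `|x * z - y * w| <= (`|y| + `|x|) * K.
  move=> zK wK; apply: le_trans (ler_normB _ _) _; rewrite addrC mulrDl !normrM.
  by apply: lerD; apply: ler_wpM2l.
have trig (t z w K : R) : `|z| <= K -> `|w| <= K ->
    `|cos t * z + sin t * w| <= K + K.
  move=> zK wK; apply: le_trans (ler_normD _ _) _; rewrite !normrM.
  apply: lerD; rewrite -[leRHS]mul1r; apply: ler_pM => //; first exact: cos_max.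
  exact: sin_max.
have bqr (r t : R) : s < r < d ->
    `|qr r t| <= (`|A 0| + `|B 0|) * (2 ^+ m * M + 2 ^+ m * M).
  move=> h; exact: lin2 (trig _ _ _ _ (bg _ r t h (bA ix)) (bg _ r t h (bA iy)))
    (trig _ _ _ _ (bg _ r t h (bB ix)) (bg _ r t h (bB iy))).
have bq (r t : R) : s < r < d -> `|q r t| <= (`|A 0| + `|B 0|) * (C * S).
  by move=> h; apply: lin2; [apply: bdA|apply: bdB] => c; exact: inU.
have per (r : R) : s < r < d -> p r 0 = p r (pi *+ 2).
  by move=> _; rewrite /p /cyl cos0 sin0 cos2pi sin2pi.
(* the nodes of the differences other than the first one are at levels at
   most 0, where the coefficient vanishes *)
have van (z : 'rV[R]_3) j : z 0 it = s -> (0 < j <= m)%N -> (z - (j%:R * s) *: e) 0 it <= 0.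
  move=> zs /andP[j0 _]; rewrite !mxE zs !eqxx mulr1 subr_le0.
  by rewrite ler_peMl ?(ltW s0) // ler1n.
have sysE (r t : R) : s < r < d -> let z := cyl s r t in
    gP ix z + gQ iy z =
      'D_(std_basis iy) f z * A z - f z * 'D_(std_basis iy) A z /\
    gQ ix z - gP iy z =
      'D_(std_basis iy) f z * B z - f z * 'D_(std_basis iy) B z.
  move=> h z; have zs : z 0 it = s by have [] := cylE s r t.
  have f0 (w : 'rV[R]_3) : w 0 it <= 0 -> f w = 0 by exact: plane_class_eq0 (leaf_coef_class a) w.
  rewrite /gP /gQ -bdiffD -bdiffB; split.
    rewrite bdiff_vanish => [|j jm]; first by apply: eq1; exact: inU0.
    rewrite eq1; last by apply: inUj h _; case/andP: jm.
    have w0 := van z j zs jm.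
    by rewrite (f0 _ w0) (leaf_coef_dy0 a1 w0) !mul0r subrr.
  rewrite bdiff_vanish => [|j jm]; first by apply: eq2; exact: inU0.
  rewrite eq2; last by apply: inUj h _; case/andP: jm.
  have w0 := van z j zs jm.
  by rewrite (f0 _ w0) (leaf_coef_dy0 a1 w0) !mul0r subrr.
pose C' := 14 * (`|A 0| + `|B 0|) * M * S.
have ineq (r t : R) : s < r < d ->
    qr r t <= - (pt r t / r) - N * S / 2 * (sin t * cos t) ^+ 2 / r + C'.
  move=> h; have [sr rd] := andP h; have r0 := lt_trans s0 sr.
  have [E1 E2] := sysE r t h.
  set z := cyl s r t in E1 E2.
  have zs : z 0 it = s by have [] := cylE s r t.
  have nz : `|z| <= r.
    by apply: cyl_norm; rewrite gtr0_norm // ltW.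
  have fS : `|f z| <= S.
    have s0' : 0 < z 0 it by rewrite zs.
    have := half_monomial_le a (isT : (0 + 2 <= 1.*2)%N) s0'.
    by rewrite zs addrK.
  have [yS xyS] : `|'D_(std_basis iy) f z| <= 2 * S / r /\
      S * (sin t * cos t) ^+ 2 / (2 * r) <= sin t * 'D_(std_basis iy) f z.
    by apply: leaf_coef_cyl_dy; rewrite s0.
  have lip (F : 'rV[R]_3 -> R) : (forall q, U q -> differentiable F q) ->
      (forall j q, U q -> `|'D_(std_basis j) F q| <= M) -> `|F z - F 0| <= 3 * M * r.
    move=> dF bF; apply: le_trans (gradient_lipschitz dU dF bF _) _.
      exact: le_lt_trans nz rd.
    by apply: ler_wpM2l => //; rewrite mulr_ge0.
  have H := obstruction_algebra (ltW S0) r0 M0 (cos_max t) (sin_max t) yS xyS fS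
    (lip A dA bA) (lip B dB bB) (bA iy z (inU0 r t h)) (bB iy z (inU0 r t h)).
  rewrite -E1 -E2 in H.
  have -> : qr r t = - (pt r t / r) +
     (cos t * (B 0 * (gP ix z + gQ iy z) - A 0 * (gQ ix z - gP iy z)) -
      sin t * (A 0 * (gP ix z + gQ iy z) + B 0 * (gQ ix z - gP iy z))).
    rewrite /qr /pt -/z; move: (gP ix z) (gP iy z) (gQ ix z) (gQ iy z) => x y w v.
    by field; rewrite gt_eqF.
  by rewrite -addrA lerD2l; exact: H.
have ss : s < 2 * s by rewrite mulr2n mulrDl mul1r ltrDl.
have := polar_log_bound (ltW s0) dq dp cq cqr cpt bqr bq per ineq ss sb bd.
rewrite /C'; move: (ln b) (ln (2 * s)) => l1 l2 H.
rewrite -(ler_pM2l S0); apply: le_trans (le_trans _ H) _.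
  by rewrite le_eqVlt; apply/orP; left; apply/eqP; ring.
by rewrite le_eqVlt; apply/orP; left; apply/eqP; ring.
Qed.

(** The solutions of h_x + (r - i) h_y = r_y h near the origin which do not
    vanish there are not of class C^a. *)
Lemma obstruction (a : R) (U : set 'rV[R]_3) (A B : 'rV[R]_3 -> R) :
  let f := leaf_coef a in
  1 < a -> open U -> U 0 -> holder_zygmund U a A -> holder_zygmund U a B ->
  A 0 ^+ 2 + B 0 ^+ 2 != 0 ->
  (forall p, U p -> 'D_(std_basis ix) A p + 'D_(std_basis iy) B p =
      'D_(std_basis iy) f p * A p - f p * 'D_(std_basis iy) A p) ->
  (forall p, U p -> 'D_(std_basis ix) B p - 'D_(std_basis iy) A p =
      'D_(std_basis iy) f p * B p - f p * 'D_(std_basis iy) B p) -> False.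
Proof.
move=> f a1 oU U0 hA hB N0 eq1 eq2; have a0 := lt_trans ltr01 a1.
have /nbhs_ballP[d /= d0 dU'] := open_nbhs_nbhs (conj oU U0).
have dU (q : 'rV[R]_3) : `|q| < d -> U q.
  by move=> qd; apply: dU'; rewrite -ball_normE /= sub0r normrN.
have bound (F : 'rV[R]_3 -> R) : holder_zygmund U a F -> exists2 M, 0 <= M &
    forall j q, U q -> `|'D_(std_basis j) F q| <= M.
  move=> hF; apply: (@uniform_bound R 3 (fun j M => forall q, U q ->
      `|'D_(std_basis j) F q| <= M)) => [j M M' MM H q Uq|j].
    exact: le_trans (H q Uq) MM.
  by have [_ _ /(_ j)/holder_zygmund_bounded[]] := holder_zygmund_inv a1 hF.
have [MA MA0 bA] := bound A hA; have [MB MB0 bB] := bound B hB.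
pose M := MA + MB; have M0 : 0 <= M by exact: addr_ge0.
have bA' j q : U q -> `|'D_(std_basis j) A q| <= M.
  by move=> Uq; apply: le_trans (bA j q Uq) _; rewrite lerDl.
have bB' j q : U q -> `|'D_(std_basis j) B q| <= M.
  by move=> Uq; apply: le_trans (bB j q Uq) _; rewrite lerDr.
have [mA HmA] := holder_zygmund_bdiff it hA.
have [mB HmB] := holder_zygmund_bdiff it hB.
pose m := maxn mA mB.
have [CA HCA] := HmA m (leq_maxl _ _); have [CB HCB] := HmB m (leq_maxr _ _).
pose C := Num.max CA CB.
pose K := 2 * ((`|A 0| + `|B 0|) * C) + 14 * (`|A 0| + `|B 0|) * M * d.
pose N := A 0 ^+ 2 + B 0 ^+ 2.
have Np : 0 < N by rewrite lt_neqAle eq_sym N0 addr_ge0 ?sqr_ge0.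
pose X := 16 / N * (`|K| + 1).
have X0 : 0 < X by rewrite mulr_gt0 ?divr_gt0 // ltr_wpDl.
(* a level so small that the logarithm exceeds every bound *)
pose s := Num.min (d / (2 * m.+1%:R)) (d / 4 * expR (- X)).
have m0 : 0 < m.+1%:R :> R by rewrite ltr0n.
have s0 : 0 < s.
  by rewrite lt_min !mulr_gt0 ?expR_gt0 ?invr_gt0 ?mulr_gt0.
have s1 : s <= d / (2 * m.+1%:R) by rewrite ge_min lexx.
have s2 : s <= d / 4 * expR (- X) by rewrite ge_min lexx orbT.
have msd : m.+1%:R * s < d.
  apply: (@le_lt_trans _ _ (d / 2)); last first.
    by rewrite ltr_pdivrMr // ltr_pMr // ltr1n.
  apply: le_trans (ler_wpM2l (ltW m0) s1) _; rewrite le_eqVlt; apply/orP; left.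
  by apply/eqP; field; rewrite addrC natr1 gt_eqF.
have s2d : 2 * s <= d / 2 * expR (- X) by move: s2; lra.
have eX1 : expR (- X) <= 1 by rewrite -expR0 ler_expR oppr_le0 ltW.
have hd0 : 0 < d / 2 by rewrite divr_gt0.
have sb : 2 * s <= d / 2.
  by apply: le_trans s2d _; rewrite ler_piMr // ltW.
have bd : d / 2 < d by rewrite ltr_pdivrMr // ltr_pMr // ltr1n.
have S0 : 0 <= s `^ a by exact: powR_ge0.
have bdA p : (forall t, 0 <= t <= m%:R * s -> U (p - t *: e)) ->
    `|bdiff e m s A p| <= C * s `^ a.
  move=> H; apply: le_trans (HCA p s s0 H) _.
  by rewrite ler_wpM2r // le_max lexx.
have bdB p : (forall t, 0 <= t <= m%:R * s -> U (p - t *: e)) ->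
    `|bdiff e m s B p| <= C * s `^ a.
  move=> H; apply: le_trans (HCB p s s0 H) _.
  by rewrite ler_wpM2r // le_max lexx orbT.
have L := @obstruction_level a d M C s (d / 2) m U A B a1 dU
  (holder_zygmund_differentiable oU a1 hA) (holder_zygmund_differentiable oU a1 hB)
  (fun j => holder_zygmund_partial_continuous (j := j) a1 hA)
  (fun j => holder_zygmund_partial_continuous (j := j) a1 hB)
  bA' bB' M0 s0 msd bdA bdB eq1 eq2 sb bd.
have lnX : X <= ln (d / 2) - ln (2 * s).
  have lnE : ln (d / 2 * expR (- X)) = ln (d / 2) - X.
    by rewrite lnM ?posrE ?expR_gt0 // expRK.
  have : ln (2 * s) <= ln (d / 2 * expR (- X)).
    by rewrite ler_ln ?posrE ?mulr_gt0 ?expR_gt0 // invr_gt0.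
  by rewrite lnE; move: (ln _) (ln _) => l1 l2; lra.
have : N / 2 / 8 * X <= K.
  apply: (@le_trans _ _ (N / 2 / 8 * (ln (d / 2) - ln (2 * s)))).
    by rewrite ler_wpM2l // !divr_ge0 // ltW.
  apply: le_trans L _; rewrite /K lerD2l ler_wpM2l //.
    by rewrite !mulr_ge0 // addr_ge0.
  by move: s0 d0; lra.
have -> : N / 2 / 8 * X = `|K| + 1 by rewrite /X; field; rewrite gt_eqF.
by move=> h; have := le_trans h (ler_norm K); rewrite gerDl ler10.
Qed.

End obstruction.

Theorem theorem1p3 (R : realType) (alpha : R) (halpha : 1 < alpha) :
  exists S : cdistribution R,
    [/\ frobenius_structure alpha S,
        has_rank 1 S,
        has_rank 2 (add_bundle S (conj_bundle S)) &
        ~ exists (U : set 'rV[R]_3) (F Phi : 'rV[R]_3 -> 'rV[R]_3),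
            [/\ U 0,
                C1_chart U F Phi,
                (forall p, U p -> S p = <[pullback_dz F Phi p]>%VS) &
                componentwise (holder_zygmund U alpha) (pullback_dz F Phi)]].
Proof.
have a0 : 0 < alpha := lt_trans ltr01 halpha.
exists (leaf_bundle (leaf_coef alpha)); split.
- apply: leaf_bundle_frobenius => //; last exact: leaf_coef_derivable.
  by move=> p e; exact: leaf_coef_holder_zygmund.
- exact: leaf_bundle_rank.
- exact: leaf_sum_rank.
move=> [U [F [Phi [U0 ch SU HZ]]]].
have [oU _ _ _ _] := ch; have [hA hB] := HZ (inord 0).
have eqs := chart_equations halpha (leaf_coef_derivable halpha) ch SU HZ.
have [N0 _ _] := eqs 0 U0.
apply: (obstruction halpha oU U0 hA hB N0) => p Up; first by have [] := eqs p Up.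
by have [] := eqs p Up.
Qed.
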